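(* Let $n\ge2$ and $d\ge2$ be integers, $\alpha>0$, $\tau=2\pi/n$. Let $$\Lambda=\{y\in H^1_{2\pi}(\mathbb{R},\mathbb{R}^d): y(t)\ne y(t+h\tau)\ \text{for all } t\in\mathbb{R},\ h=1,\dots,n-1\}$$ and, for $\omega>0$ and $y\in\Lambda$, $$\mathcal{A}(y)=\frac12\int_0^{2\pi}|\dot y(t)+\omega Jy(t)|^2\,dt+\frac12\sum_{h=1}^{n-1}\int_0^{2\pi}\frac{dt}{|y(t)-y(t+h\tau)|^\alpha},$$ where $J$ is the linear map $J(y^1,y^2,y^3,\dots,y^d)=(-y^2,y^1,0,\dots,0)$. Let $k$ be a positive integer such that $n$ and $k$ are coprime. Then there exists $\epsilon=\epsilon(\alpha,n,k)>0$ such that, if $\omega\in(k-\epsilon,k+\epsilon)$ and $\omega\notin\mathbb{N}$, the minimum of $\mathcal{A}$ on $\Lambda$ is attained on a circle with minimal period $2\pi/k$ that lies in the rotating plane, with radius depending on $n$, $\alpha$ and $\omega$.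
   Context: $H^1_{2\pi}(\mathbb{R},\mathbb{R}^d)$ is the space of $2\pi$-periodic functions that are locally in the Sobolev class $H^1$. $\mathcal{A}$ is the Lagrangian action of $n$ equal unit masses $y_i(t)=y(t+i\tau)$, $i=0,\dots,n-1$, in a frame rotating with angular velocity $\omega$ in the plane of the first two coordinates, called the rotating plane (when $d=2$, $\mathbb{R}^2\cong\mathbb{C}$, the map $J$ is multiplication by the complex unit). A circle is a loop traversing a round circle with constant speed. *)

(* Defs.v *)
From HB Require Import structures.
From mathcomp Require Import all_boot all_order all_algebra.
From mathcomp Require Import all_classical all_reals all_analysis.
Set Implicit Arguments.
Unset Strict Implicit.
Unset Printing Implicit Defensive.
Import Order.TTheory GRing.Theory Num.Theory.
Import numFieldNormedType.Exports.
Local Open Scope classical_set_scope.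
Local Open Scope ring_scope.

(* The library norm on row vectors is the sup norm, hence the following. *)
Definition edot (R : realType) (d : nat) (u v : 'rV[R]_d) : R :=
  \sum_(j < d) u 0 j * v 0 j.

Definition enorm (R : realType) (d : nat) (u : 'rV[R]_d) : R :=
  Num.sqrt (edot u u).

(* (y^1, y^2, y^3, ..., y^d) |-> (- y^2, y^1, 0, ..., 0); coordinates are
   numbered from 0 and the matrix acts on row vectors from the right. *)
Definition J_mx (R : realType) (d : nat) : 'M[R]_d :=
  \matrix_(i, j) (if (i == 1 :> nat) && (j == 0 :> nat) then -1
                  else if (i == 0 :> nat) && (j == 1 :> nat) then 1 else 0).

Definition J (R : realType) (d : nat) (u : 'rV[R]_d) : 'rV[R]_d :=
  u *m J_mx R d.

(* C^1 test functions define the same weak derivatives as C^oo ones. *)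
Definition test_function (R : realType) (phi : R -> R) : Prop :=
  [/\ forall x, derivable phi x 1,
      continuous (derive1 phi) &
      compact (closure [set x | phi x != 0])].

Definition is_weak_derivative (R : realType) (f g : R -> R) : Prop :=
  [/\ locally_integrable setT f,
      locally_integrable setT g &
      forall phi : R -> R, test_function phi ->
        (\int[lebesgue_measure]_x (f x * derive1 phi x) =
         - \int[lebesgue_measure]_x (g x * phi x))%R].

Definition L2_loc (R : realType) (f : R -> R) : Prop :=
  measurable_fun setT f /\ locally_integrable setT (fun x => f x ^+ 2).

Definition is_H1_derivative (R : realType) (d : nat) (y v : R -> 'rV[R]_d) :
    Prop :=
  forall j : 'I_d, L2_loc (fun t => v t 0 j) /\
    is_weak_derivative (fun t => y t 0 j) (fun t => v t 0 j).

Definition H1_loc (R : realType) (d : nat) (y : R -> 'rV[R]_d) : Prop :=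
  (forall j : 'I_d, L2_loc (fun t => y t 0 j)) /\
  exists v : R -> 'rV[R]_d, is_H1_derivative y v.

(* An element of the Sobolev class is represented by its continuous
   representative, so that its pointwise values make sense. *)
Definition H1_2pi (R : realType) (d : nat) (y : R -> 'rV[R]_d) : Prop :=
  [/\ continuous y, periodic y (2 * pi) & H1_loc y].

(* The weak derivative, determined up to a null set when y is in H1_loc
   (and the junk value 0 otherwise). *)
Definition weak_derivative (R : realType) (d : nat) (y : R -> 'rV[R]_d) :
    R -> 'rV[R]_d :=
  xget (fun=> 0) [set v | is_H1_derivative y v].

Definition tau (R : realType) (n : nat) : R := 2 * pi / n%:R.

Definition Lambda (R : realType) (d n : nat) : set (R -> 'rV[R]_d) :=
  [set y | H1_2pi y /\
     forall (t : R) (h : nat), (1 <= h < n)%N -> y t <> y (t + h%:R * tau R n)].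

Definition lagrangian_action (R : realType) (d n : nat) (alpha omega : R)
    (y : R -> 'rV[R]_d) : \bar R :=
  (2^-1%:E * \int[lebesgue_measure]_(t in `[0%R, (2 * pi)%R])
      (enorm (weak_derivative y t + omega *: J (y t)) ^+ 2)%:E
   + 2^-1%:E * \sum_(1 <= h < n) \int[lebesgue_measure]_(t in `[0%R, (2 * pi)%R])
      ((enorm (y t - y (t + h%:R * tau R n)) `^ alpha)^-1)%:E)%E.

Definition is_circle (R : realType) (d : nat) (y : R -> 'rV[R]_d) (r : R) :
    Prop :=
  0 < r /\
  exists (c u v : 'rV[R]_d) (sigma : R),
    [/\ enorm u = 1, enorm v = 1, edot u v = 0, 0 < sigma &
        forall t, y t = c + r *: (cos (sigma * t) *: u + sin (sigma * t) *: v)].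

Definition is_minimal_period (R : realType) (d : nat) (y : R -> 'rV[R]_d)
    (T : R) : Prop :=
  [/\ 0 < T, periodic y T & forall s, 0 < s -> periodic y s -> T <= s].

Definition in_rotating_plane (R : realType) (d : nat) (y : R -> 'rV[R]_d) :
    Prop :=
  forall (t : R) (j : 'I_d), (2 <= j)%N -> y t 0 j = 0.

(* Main.v *)
Require Import Defs.
From HB Require Import structures.
From mathcomp Require Import all_boot all_order all_algebra.
From mathcomp Require Import all_classical all_reals all_analysis.
From mathcomp Require Import measurable_realfun ring lra.
Import Order.TTheory GRing.Theory Num.Theory.
Import numFieldNormedType.Exports.
Local Open Scope classical_set_scope.
Local Open Scope ring_scope.

Set Implicit Arguments.
Unset Strict Implicit.
Unset Printing Implicit Defensive.

(** Why circles win.  Write T = 2 pi, delta = omega - k, and Delta_h z(t) =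
    z(t) - z(t + h tau).  A circle that turns k times per period against the
    rotation of the frame has the small angular velocity delta in the inertial
    frame, so its kinetic term is of order delta^2, whereas any other oscillation
    of a loop costs a fixed multiple of its square norm.

    The potential s |-> s^(-alpha/2) is convex in s = |Delta_h z|^2, hence lies
    above its tangent line at the value s_h that s takes on the circle of radius
    r ([powR_inv_tangent]).  Replacing the potential by these tangent lines
    leaves a quadratic functional, and minimality reduces to
<<
  delta^2 * sum_h kap_h int |Delta_h z|^2  <=  int |z' + omega J z|^2,
>>
    where kap_h are positive weights with sum_h kap_h c_h^2 = 1, c_h being the
    chords of the unit circle ([weight_chord_sum1]).  The radius is the one for
    which the slopes of the tangent lines are delta^2 kap_h; then both the
    tangent lines and the quadratic inequality are exact on the circle
    ([action_ge], [circle_action]).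

    For the quadratic inequality, pass to p = exp(i k t) (z_0 + i z_1) in the
    rotating plane, which turns z' + i omega z into p' + i delta p
    ([planar_kinetic_ge]), and split p into its mean and a part of mean zero.
    The two parts are orthogonal for both sides.  On the mean, which is the
    component of z along the circle, both sides are equal.  On the part of mean
    zero a Poincare inequality bounds the right side below by a fixed multiple
    of int |p'|^2, and the left side is at most a constant times
    delta^2 int |p'|^2 ([planar_difference_le]).  The components orthogonal to
    the rotating plane are treated in the same way, without rotation
    ([scalar_difference_le]).  As epsilon is free, a Poincare inequality with a
    crude constant is enough, and no Fourier series is involved.

    The analytic input is that a continuous function with weak derivative g has
    the integral of g as its increments ([weak_FTC]).  It yields the Poincare
    inequality, and, with the differentiation theorem of Lebesgue, the
    almost everywhere uniqueness of weak derivatives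
    ([weak_derivative_ae_unique]), by which the action of the circle may be
    computed with its classical derivative. *)

(** * Locally integrable functions and integrals over segments *)

Local Notation locint := (locally_integrable setT).
Local Notation Int a b f := (\int[lebesgue_measure]_(x in `[a, b]) f x)%R.

Section LocallyIntegrable.
Context {R : realType}.
Notation mu := (@lebesgue_measure R).
Implicit Types (f g c : R -> R) (a b : R).

Lemma locint_compact f K : locint f -> compact K ->
  mu.-integrable K (EFin \o f).
Proof.
move=> [mf _ If] cK; apply/integrableP; split; last exact: If.
by apply/measurable_EFinP; exact: measurable_funTS.
Qed.

Lemma locint_itv f a b : locint f -> mu.-integrable `[a, b] (EFin \o f).
Proof. by move=> lf; apply: locint_compact => //; exact: segment_compact. Qed.

Lemma compact_locint f : measurable_fun setT f ->
  (forall K, compact K -> mu.-integrable K (EFin \o f)) -> locint f.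
Proof.
move=> mf cf; split => //; first exact: openT.
by move=> K _ /cf /integrableP[].
Qed.

Lemma locint_continuous f : continuous f -> locint f.
Proof.
move=> cf; apply: compact_locint; first exact: continuous_measurable_fun.
move=> K cK; apply: continuous_compact_integrable => //.
exact: continuous_subspaceT.
Qed.

Lemma locint_le f g : measurable_fun setT f -> locint g ->
  (forall x, `|f x| <= `|g x|) -> locint f.
Proof.
move=> mf lg fg; apply: compact_locint => // K cK.
apply: (le_integrable _ _ _ (locint_compact lg cK)).
- exact: compact_measurable.
- by apply/measurable_EFinP; exact: measurable_funTS.
- by move=> x _ /=; rewrite lee_fin.
Qed.

Lemma locint_ext f g : f =1 g -> locint f -> locint g.
Proof. by move=> /funext ->. Qed.

Lemma locint_cst (k : R) : locint (fun _ : R => k).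
Proof. by apply: locint_continuous => x; exact: cvg_cst. Qed.

Lemma locintD f g : locint f -> locint g -> locint (fun x => f x + g x).
Proof. exact: locally_integrableD. Qed.

Lemma locintB f g : locint f -> locint g -> locint (fun x => f x - g x).
Proof. exact: locally_integrableB. Qed.

(** A continuous factor is bounded on each compact set. *)
Lemma locintM f c : locint f -> continuous c -> locint (fun x => f x * c x).
Proof.
move=> lf cc; have mc := continuous_measurable_fun cc.
have [mf _ _] := lf.
have mfc : measurable_fun setT (fun x => f x * c x) by exact: measurable_funM.
apply: compact_locint => // K cK.
have [|M [Mr MK]] := @compact_bounded _ _ (c @` K).
  by apply: continuous_compact => //; exact: continuous_subspaceT.
have lg : locint (fun x => (`|M| + 1) * f x).
  have [mg _ _] := lf; apply: compact_locint.
    by apply: measurable_funM => //; exact: measurable_cst.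
  move=> K' cK'; rewrite [X in integrable _ _ X](_ : _ =
    (fun x => ((`|M| + 1)%:E * (EFin \o f) x)%E)); last first.
    by apply/funext => x /=; rewrite EFinM.
  by apply: integrableZl; [exact: compact_measurable|exact: locint_compact].
apply: (le_integrable _ _ _ (locint_compact lg cK)).
- exact: compact_measurable.
- by apply/measurable_EFinP; exact: measurable_funTS.
- move=> x Kx /=; rewrite lee_fin !normrM mulrC ler_wpM2r//.
  rewrite [leRHS]ger0_norm ?addr_ge0//; apply: (MK (`|M| + 1)); last by exists x.
  by rewrite (le_lt_trans (ler_norm _))// ltrDl.
Qed.

Lemma locintZ (k : R) f : locint f -> locint (fun x => k * f x).
Proof.
move=> lf; apply: (@locint_ext (fun x => f x * k)); first by move=> x; rewrite mulrC.
by apply: (@locintM _ (fun=> k)) => // x; exact: cvg_cst.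
Qed.

Lemma IntD a b f g : locint f -> locint g ->
  Int a b (fun x => f x + g x) = Int a b f + Int a b g.
Proof. by move=> lf lg; rewrite RintegralD//; exact: locint_itv. Qed.

Lemma IntB a b f g : locint f -> locint g ->
  Int a b (fun x => f x - g x) = Int a b f - Int a b g.
Proof. by move=> lf lg; rewrite RintegralB//; exact: locint_itv. Qed.

Lemma IntZ a b (k : R) f : locint f ->
  Int a b (fun x => k * f x) = k * Int a b f.
Proof. by move=> lf; rewrite RintegralZl//; exact: locint_itv. Qed.

Lemma Int_cst a b (k : R) : a <= b -> Int a b (fun=> k) = k * (b - a).
Proof.
move=> ab; rewrite Rintegral_cst//= lebesgue_measure_itv/= lte_fin.
by case: ltP => //= ba; rewrite (le_anti (introT andP (conj ab ba))) subrr.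
Qed.

Lemma le_Int a b f g : locint f -> locint g ->
  (forall x, a <= x <= b -> f x <= g x) -> Int a b f <= Int a b g.
Proof.
by move=> lf lg fg; apply: le_Rintegral => //; exact: locint_itv.
Qed.

Lemma Int_ge0 a b f : (forall x, 0 <= f x) -> 0 <= Int a b f.
Proof. by move=> f0; apply: Rintegral_ge0. Qed.

Lemma eq_Int a b f g : f =1 g -> Int a b f = Int a b g.
Proof. by move=> fg; apply: eq_Rintegral => x _; rewrite fg. Qed.

Lemma Int_cat a b (c : R) f : locint f -> a <= b -> b <= c ->
  Int a c f = Int a b f + Int b c f.
Proof.
move=> lf ab bc.
have := @Rintegral_itvB R f (BLeft a) (BRight c) b (locint_itv a c lf).
rewrite !bnd_simp => /(_ ab bc) H.
rewrite -(Rintegral_itv_obnd_cbnd (r := b)); last first.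
  apply: (integrableS _ _ _ (locint_itv b c lf)) => //.
  exact: subset_itv_oc_cc.
by rewrite -H addrC subrK.
Qed.

Lemma continuous_derivable f : (forall x, derivable f x 1) -> continuous f.
Proof. by move=> df x; apply/differentiable_continuous/derivable1_diffP. Qed.

Lemma derivable_LR f a b : (forall x, derivable f x 1) ->
  derivable_oo_LRcontinuous f a b.
Proof.
move=> df; have cf := continuous_derivable df.
split=> [x _||]; first exact: df.
- by apply: cvg_at_right_filter; exact: cf.
- by apply: cvg_at_left_filter; exact: cf.
Qed.

Lemma Int_derive1 (F : R -> R) a b : a <= b ->
  (forall x, derivable F x 1) -> continuous (derive1 F) ->
  Int a b (derive1 F) = F b - F a.
Proof.
rewrite le_eqVlt => /predU1P[<- _ _|ab dF cF].
  by rewrite set_itv1 Rintegral_set1 subrr.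
rewrite /Rintegral (@continuous_FTC2 R (derive1 F) F)//.
- exact: continuous_subspaceT.
- exact: derivable_LR.
Qed.

End LocallyIntegrable.

(** * A step function of class C^1 *)

Section SmoothStep.
Context {R : realType}.
Implicit Types (x a b m : R).

Definition pospart x : R := Num.max x 0.

Lemma pospart_continuous : continuous pospart.
Proof.
move=> x; apply: (@continuous_max R _ (fun y : R => y) (fun=> 0)); first exact: cvg_id.
exact: cvg_cst.
Qed.

(** A remainder bounded by h^2 avoids any gluing at the kink of the positive
    part. *)
Lemma is_derive_quadratic (F : R -> R) x (l : R) :
  (forall h, `|F (x + h) - F x - h * l| <= h ^+ 2) -> is_derive x 1 F l.
Proof.
move=> H; suff cl : h^-1 *: ((F \o shift x) (h *: 1) - F x) @[h --> 0^'] --> l.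
  by apply: DeriveDef; [apply/cvg_ex; exists l|exact: cvg_lim].
apply/cvgrPdist_le => e e0; near=> h.
have h0 : h != 0 by near: h; exact: nbhs_dnbhs_neq.
have he : `|h| <= e.
  near: h; apply: nbhs_dnbhs; exact: (@nbhs0_le R R e e0).
rewrite /= distrC /shift /= (_ : h *: 1 = h); last by rewrite /GRing.scale/= mulr1.
rewrite (_ : _ - l = h^-1 * (F (x + h) - F x - h * l)); last first.
  by rewrite [RHS]mulrBr mulKf// (addrC h).
rewrite normrM normfV ler_pdivrMl ?normr_gt0//.
rewrite (le_trans (H h))// -normr_id -(real_normK (num_real h)) normr_id expr2.
by rewrite ler_wpM2l.
Unshelve. all: by end_near. Qed.

Lemma is_derive_pospart2 x :
  is_derive x 1 (fun x => pospart x ^+ 2) (2 * pospart x).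
Proof.
(* on every combination of signs the remainder lies between 0 and h^2 *)
apply: is_derive_quadratic => h; rewrite /pospart ler_norml.
by case: (leP x 0) => x0; case: (leP (x + h) 0) => xh0; apply/andP; split; nra.
Qed.

(** The coefficients 1, -2, 1 at 0, 1/2, 1 are those of a second difference:
    they cancel the quadratic and linear terms beyond 1. *)
Definition smoothstep x :=
  2 * (pospart x ^+ 2 - 2 * pospart (x - 2^-1) ^+ 2 + pospart (x - 1) ^+ 2).

Definition tent x :=
  4 * (pospart x - 2 * pospart (x - 2^-1) + pospart (x - 1)).

Lemma is_derive_smoothstep x : is_derive x 1 smoothstep (tent x).
Proof.
have D c : is_derive x 1 (fun x => pospart (x - c) ^+ 2) (2 * pospart (x - c)).
  have d1 : is_derive x 1 (fun x => x - c) 1.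
    by apply: is_derive_eq; rewrite subr0.
  have := @is_derive1_comp R (fun x => pospart x ^+ 2) (fun x => x - c) x _ _
    (is_derive_pospart2 _) d1.
  by rewrite mulr1.
have D0 := is_derive_pospart2 x; have D1 := D 2^-1; have D2 := D 1.
rewrite /smoothstep.
apply: is_derive_eq.
by rewrite /tent /GRing.scale/=; ring.
Qed.

Lemma tent_continuous : continuous tent.
Proof.
have cp c : continuous (fun x => pospart (x - c)).
  move=> x; apply: (@continuous_comp _ _ _ (fun x => x - c) pospart).
    by apply: cvgB; [exact: cvg_id|exact: cvg_cst].
  exact: pospart_continuous.
move=> x; apply: cvgM; first exact: cvg_cst.
apply: cvgD; last exact: cp.
apply: cvgB; first exact: pospart_continuous.
by apply: cvgM; [exact: cvg_cst|exact: cp].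
Qed.

Lemma smoothstep_le0 x : x <= 0 -> smoothstep x = 0.
Proof.
by move=> x0; rewrite /smoothstep /pospart !max_r//; try lra; ring.
Qed.

Lemma smoothstep_ge1 x : 1 <= x -> smoothstep x = 1.
Proof.
by move=> x0; rewrite /smoothstep /pospart !max_l//; try lra; field.
Qed.

Lemma smoothstep_itv x : 0 <= smoothstep x <= 1.
Proof.
rewrite /smoothstep /pospart; case: (leP x 0) => x0;
 case: (leP (x - 2^-1) 0) => x1; case: (leP (x - 1) 0) => x2;
 apply/andP; split; nra.
Qed.

Lemma tent_ge0 x : 0 <= tent x.
Proof.
by rewrite /tent /pospart; case: (leP x 0) => x0;
 case: (leP (x - 2^-1) 0) => x1; case: (leP (x - 1) 0) => x2; lra.
Qed.

Lemma tent_out x : x <= 0 \/ 1 <= x -> tent x = 0.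
Proof.
by rewrite /tent /pospart; case: (leP x 0) => x0;
 case: (leP (x - 2^-1) 0) => x1; case: (leP (x - 1) 0) => x2; lra.
Qed.

Definition ramp m a x := smoothstep (m * (x - a)).
Definition dramp m a x := m * tent (m * (x - a)).

Lemma is_derive_ramp m a x : is_derive x 1 (ramp m a) (dramp m a x).
Proof.
have d1 : is_derive x 1 (fun x => m * (x - a)) m.
  by apply: is_derive_eq; rewrite subr0 /GRing.scale/= mulr1.
have := @is_derive1_comp R smoothstep (fun x => m * (x - a)) x _ _
    (is_derive_smoothstep _) d1.
by rewrite mulrC.
Qed.

Lemma derivable_ramp m a x : derivable (ramp m a) x 1.
Proof. by have [] := is_derive_ramp m a x. Qed.

Lemma derive1_ramp m a : derive1 (ramp m a) = dramp m a.
Proof.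
apply/funext => x; rewrite derive1E.
exact: (@derive_val _ _ _ _ _ _ _ (is_derive_ramp m a x)).
Qed.

Lemma dramp_continuous m a : continuous (dramp m a).
Proof.
move=> x; apply: cvgM; first exact: cvg_cst.
apply: (@continuous_comp _ _ _ (fun x => m * (x - a)) tent).
  apply: cvgM; first exact: cvg_cst.
  by apply: cvgB; [exact: cvg_id|exact: cvg_cst].
exact: tent_continuous.
Qed.

Lemma dramp_ge0 m a x : 0 <= m -> 0 <= dramp m a x.
Proof. by move=> m0; rewrite mulr_ge0// tent_ge0. Qed.

End SmoothStep.

(** * Increments of a weakly differentiable function *)

Section WeakFTC.
Context {R : realType}.
Notation mu := (@lebesgue_measure R).
Implicit Types (f g h : R -> R) (a b m : R).

Lemma Rintegral_support (A B : set R) h : A `<=` B ->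
  (forall x, B x -> ~ A x -> h x = 0) ->
  \int[mu]_(x in B) h x = \int[mu]_(x in A) h x.
Proof.
move=> AB h0; rewrite Rintegral_mkcond [RHS]Rintegral_mkcond.
apply: eq_Rintegral => x _; rewrite !patchE.
case: ifPn => [/set_mem Bx|/negP xB]; case: ifPn => // xA.
- by rewrite h0// => /mem_set; exact/negP.
- by case: xB; move/set_mem : xA => /AB /mem_set.
Qed.

(** Tends to the indicator of the segment from a to b as m grows. *)
Definition plateau m a b x := ramp m a x - ramp m b x.

Lemma plateau_out m a b x : 1 <= m -> a <= b ->
  x < a \/ b + 1 < x -> plateau m a b x = 0.
Proof.
move=> m1 ab; rewrite /plateau /ramp => -[xa|bx].
  by rewrite !smoothstep_le0 ?subrr//; nra.
by rewrite !smoothstep_ge1 ?subrr//; nra.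
Qed.

Lemma plateau_le1 m a b x : `|plateau m a b x| <= 1.
Proof.
rewrite /plateau /ramp ler_norml.
have /andP[? ?] := smoothstep_itv (m * (x - a)).
have /andP[? ?] := smoothstep_itv (m * (x - b)).
by apply/andP; split; lra.
Qed.

Lemma derivable_plateau m a b x : derivable (plateau m a b) x 1.
Proof. by apply: derivableB; exact: derivable_ramp. Qed.

Lemma derive1_plateau m a b :
  derive1 (plateau m a b) = fun x => dramp m a x - dramp m b x.
Proof.
apply/funext => x; rewrite derive1E deriveB; [|exact: derivable_ramp..].
by rewrite -!derive1E !derive1_ramp.
Qed.

Lemma test_function_plateau m a b : 1 <= m -> a <= b ->
  test_function (plateau m a b).
Proof.
move=> m1 ab; split.
- by move=> x; exact: derivable_plateau.
- rewrite derive1_plateau => x.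
  by apply: cvgB; exact: dramp_continuous.
- apply: (subclosed_compact _ (@segment_compact R a (b + 1))).
    exact: closed_closure.
  rewrite [X in _ `<=` X](closure_id _).1; last exact: itv_closed.
  apply: closure_subset => x /= /eqP px; rewrite in_itv/=.
  apply/andP; split; rewrite leNgt; apply/negP => xx; apply: px.
    by apply: plateau_out => //; left.
  by apply: plateau_out => //; right.
Qed.

Lemma dramp_out m a x : 0 < m -> x <= a \/ a + m^-1 <= x -> dramp m a x = 0.
Proof.
move=> m0 xa; rewrite /dramp tent_out ?mulr0//; case: xa => xa; [left|right].
  by rewrite pmulr_rle0// subr_le0.
by rewrite -(mulfV (lt0r_neq0 m0)) ler_pM2l// lerBrDl.
Qed.

Lemma Int_dramp m a : 0 < m -> Int a (a + m^-1) (dramp m a) = 1.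
Proof.
move=> m0; rewrite -derive1_ramp Int_derive1.
- rewrite /ramp smoothstep_ge1 ?smoothstep_le0 ?subr0//.
    by rewrite subrr mulr0.
  by rewrite addrAC subrr add0r mulfV ?gt_eqF.
- by rewrite lerDl invr_ge0 ltW.
- by move=> x; exact: derivable_ramp.
- by rewrite derive1_ramp; exact: dramp_continuous.
Qed.

(** The derivative of a ramp is a nonnegative kernel of integral 1 supported
    in [a, a + 1/m]. *)
Lemma dramp_cvg f a : continuous f ->
  Int a (a + n.+1%:R^-1) (fun x => f x * dramp n.+1%:R a x) @[n --> \oo] --> f a.
Proof.
move=> cf; apply/cvgrPdist_le => e e0.
have [d /= d0 fd] : exists2 d : R, 0 < d & forall x, `|a - x| < d -> `|f a - f x| <= e.
  by have /cvgrPdist_le /(_ e e0) /nbhs_ballP[d d0 H] := cf a; exists d.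
near=> n.
have nd : n.+1%:R^-1 < d by near: n; exact: (near_infty_natSinv_lt (PosNum d0)).
have n0 : 0 < n.+1%:R :> R by rewrite ltr0n.
have ld : locint (dramp n.+1%:R a).
  by apply: locint_continuous; exact: dramp_continuous.
have lf : locint (fun x => f x * dramp n.+1%:R a x).
  by apply: locintM; [exact: locint_continuous|exact: dramp_continuous].
have fx x : a <= x <= a + n.+1%:R^-1 -> f a - e <= f x <= f a + e.
  move=> /andP[ax xa]; have := fd x; rewrite distrC ger0_norm ?subr_ge0//.
  rewrite ltrBlDl (le_lt_trans xa) ?ltrD2l// => /(_ isT).
  by rewrite ler_norml lerBrDl lerBlDl => /andP[? ?]; apply/andP; split; lra.
have I1 := Int_dramp a n0.
have lb : (f a - e) <= Int a (a + n.+1%:R^-1) (fun x => f x * dramp n.+1%:R a x).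
  rewrite -[leLHS]mulr1 -[X in _ * X <= _]I1 -IntZ//; apply: le_Int => //; first exact: locintZ.
  move=> x /fx /andP[? ?]; rewrite ler_wpM2r//.
  by rewrite dramp_ge0// ltW.
have ub : Int a (a + n.+1%:R^-1) (fun x => f x * dramp n.+1%:R a x) <= (f a + e).
  rewrite -[leRHS]mulr1 -[X in _ <= _ * X]I1 -IntZ//; apply: le_Int => //; first exact: locintZ.
  move=> x /fx /andP[? ?]; rewrite ler_wpM2r//.
  by rewrite dramp_ge0// ltW.
by rewrite ler_norml; apply/andP; split; lra.
Unshelve. all: by end_near. Qed.

Lemma ramp_near a x : a < x -> \forall n \near \oo, ramp n.+1%:R a x = 1.
Proof.
move=> ax; have d0 : 0 < x - a by rewrite subr_gt0.
near=> n; apply: smoothstep_ge1.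
have nd : n.+1%:R^-1 < x - a by near: n; exact: (near_infty_natSinv_lt (PosNum d0)).
by rewrite mulrC -ler_pdivrMr ?ltr0n// div1r ltW.
Unshelve. all: by end_near. Qed.

(** Ramps vanish at their base point, so the limit contains the right endpoint
    and not the left one. *)
Lemma plateau_cvg a b x : a <= b ->
  plateau n.+1%:R a b x @[n --> \oo] --> (\1_(`]a, b]%classic) x : R).
Proof.
move=> ab; apply: cvg_near_cst.
have [xa|ax] := leP x a.
  apply: nearW => n; rewrite /plateau /ramp !smoothstep_le0 ?subrr.
  - rewrite indicE memNset ?eqxx//= in_itv/= => /andP[]; lra.
  - by rewrite pmulr_rle0 ?ltr0n// subr_le0 (le_trans xa).
  - by rewrite pmulr_rle0 ?ltr0n// subr_le0.
have [xb|bx] := leP x b.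
  near=> n; have rn : ramp n.+1%:R a x = 1 by near: n; exact: ramp_near.
  rewrite /plateau rn /ramp smoothstep_le0 ?subr0.
    by rewrite indicE mem_set ?eqxx//= in_itv/= ax.
  by rewrite pmulr_rle0 ?ltr0n// subr_le0.
near=> n; have rn : ramp n.+1%:R a x = 1 by near: n; exact: ramp_near.
have rn' : ramp n.+1%:R b x = 1 by near: n; exact: ramp_near.
rewrite /plateau rn rn' subrr indicE memNset ?eqxx//= in_itv/= => /andP[]; lra.
Unshelve. all: by end_near. Qed.

Lemma Int_plateau_cvg g a b : locint g -> a <= b ->
  \int[mu]_x (g x * plateau n.+1%:R a b x) @[n --> \oo] --> Int a b g.
Proof.
move=> lg ab; have [mg _ _] := lg.
have n1 n : 1 <= n.+1%:R :> R by rewrite ler1n.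
have cp n : continuous (plateau n.+1%:R a b).
  by apply: continuous_derivable => x; exact: derivable_plateau.
have E n : \int[mu]_x (g x * plateau n.+1%:R a b x) =
    Int a (b + 1) (fun x => g x * plateau n.+1%:R a b x).
  apply: Rintegral_support => // x _ /=; rewrite in_itv/= => xab.
  rewrite plateau_out ?mulr0//.
  have [xa|ax] := ltP x a; first by left.
  by right; rewrite ltNge; apply/negP => xb; apply: xab; rewrite ax xb.
under eq_fun do rewrite E.
have -> : Int a b g = Int a (b + 1) (fun x => g x * \1_(`]a, b]%classic) x).
  rewrite -Rintegral_itv_obnd_cbnd; last first.
    apply: (integrableS _ _ _ (locint_itv a b lg)) => //.
    exact: subset_itv_oc_cc.
  rewrite (@Rintegral_support `]a, b] `[a, b + 1]) //.
  - by apply: eq_Rintegral => x xab; rewrite indicE xab mulr1.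
  - by move=> x /=; rewrite !in_itv/= => /andP[ax xb]; apply/andP; split; lra.
  - by move=> x _ xab; rewrite indicE memNset// mulr0.
apply: fine_cvg.
rewrite fineK; last first.
  apply: integrable_fin_num => //.
  apply: (le_integrable _ _ _ (locint_itv a (b + 1) lg)) => //.
    apply/measurable_EFinP/measurable_funTS; apply: measurable_funM => //.
  move=> x _ /=; rewrite lee_fin normrM ler_piMr// indicE.
  by case: (_ \in _); rewrite ?normr1 ?normr0.
have [||||||//] := @dominated_convergence _ _ R mu `[a, b + 1] _
  (fun n x => (g x * plateau n.+1%:R a b x)%:E)
  (fun x => (g x * \1_(`]a, b]%classic) x)%:E) (fun x => `|g x|%:E).
- by [].
- move=> n; apply/measurable_EFinP/measurable_funTS; apply: measurable_funM => //.
  by apply: continuous_measurable_fun; exact: cp.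
- by apply/measurable_EFinP/measurable_funTS; apply: measurable_funM.
- apply: aeW => x _; apply: cvg_EFin; first exact: nearW.
  by apply: cvgM; [exact: cvg_cst|exact: plateau_cvg].
- exact: (integrable_norm (locint_itv a (b + 1) lg)).
- apply: aeW => x n _; rewrite lee_fin normrM ler_piMr//.
  exact: plateau_le1.
Qed.

(** Test against plateaus.  Their derivatives concentrate at a and at b, where
    the continuity of f gives the two point values; the plateaus themselves stay
    bounded and converge pointwise, which gives the integral of g. *)
Theorem weak_FTC f g a b : continuous f -> is_weak_derivative f g -> a <= b ->
  Int a b g = f b - f a.
Proof.
move=> cf [_ lg fg] ab.
have n1 n : 1 <= n.+1%:R :> R by rewrite ler1n.
have n0 n : 0 < n.+1%:R :> R by rewrite ltr0n.
have lfd m c : locint (fun x => f x * dramp m c x).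
  by apply: locintM; [exact: locint_continuous|exact: dramp_continuous].
have dsupp n c : a <= c <= b ->
    Int a (b + 1) (fun x => f x * dramp n.+1%:R c x) =
    Int c (c + n.+1%:R^-1) (fun x => f x * dramp n.+1%:R c x).
  move=> /andP[ac cb]; apply: Rintegral_support.
    have : n.+1%:R^-1 <= 1 :> R by rewrite invf_le1.
    move: (n.+1%:R^-1 : R) => i i1 x /=; rewrite !in_itv/= => /andP[cx xc].
    by apply/andP; split; lra.
  move=> x _ /=; rewrite in_itv/= => xc; rewrite dramp_out ?mulr0//.
  have [?|cx] := leP x c; first by left.
  right; rewrite leNgt; apply/negP => xn; apply: xc.
  by rewrite (ltW cx) (ltW xn).
have E n : \int[mu]_x (g x * plateau n.+1%:R a b x) =
   Int b (b + n.+1%:R^-1) (fun x => f x * dramp n.+1%:R b x) -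
   Int a (a + n.+1%:R^-1) (fun x => f x * dramp n.+1%:R a x).
  have := fg _ (test_function_plateau (n1 n) ab).
  rewrite derive1_plateau => /esym/eqP; rewrite eqr_oppLR => /eqP ->.
  rewrite (@Rintegral_support `[a, b + 1] setT)//; last first.
    move=> x _ /=; rewrite in_itv/= => xab.
    have := n0 n; have : n.+1%:R^-1 <= 1 :> R by rewrite invf_le1.
    move: (n.+1%:R : R) => m ib m0.
    have [xa|ax] := leP x a.
      by rewrite (@dramp_out m a)// ?(@dramp_out m b)// ?subrr ?mulr0//; left; lra.
    have [xb|bx] := leP x (b + 1); first by case: xab; rewrite (ltW ax).
    by rewrite (@dramp_out m a)// ?(@dramp_out m b)// ?subrr ?mulr0//; right; lra.
  rewrite (@eq_Int _ _ _ _
    (fun x => f x * dramp n.+1%:R a x - f x * dramp n.+1%:R b x)); last first.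
    by move=> x; rewrite mulrBr.
  by rewrite IntB// opprB !dsupp// lexx ab.
have := Int_plateau_cvg lg ab; under eq_fun do rewrite E.
move=> /cvg_unique; apply => //.
by apply: cvgB; exact: dramp_cvg.
Qed.

End WeakFTC.

(** * Calculus of weak derivatives *)

Section WeakCalculus.
Context {R : realType}.
Notation mu := (@lebesgue_measure R).
Implicit Types (f g c v phi : R -> R) (a b : R).

(** Integrals over the line against a test function thus become integrals over
    a segment, where every integrand at hand is integrable. *)
Lemma test_function_support phi : test_function phi ->
  exists2 N : R, 0 < N &
    forall x, ~~ (- N < x < N) -> phi x = 0 /\ derive1 phi x = 0.
Proof.
move=> [_ _ /compact_bounded[M [_ MK]]].
have {}MK x : `|M| + 1 < `|x| -> phi x = 0.
  move=> Mx; apply/eqP; apply/negPn/negP => phix.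
  have := MK (`|M| + 1); rewrite (le_lt_trans (ler_norm _)) ?ltrDl// => /(_ isT).
  move=> /(_ x (@subset_closure _ [set x | phi x != 0] _ phix)) /=.
  by rewrite leNgt Mx.
exists (`|M| + 2) => [|x xM]; first by rewrite ltr_wpDl.
have Mx : `|M| + 1 < `|x|.
  rewrite -ltr_norml -leNgt in xM; rewrite (lt_le_trans _ xM)// ltrD2l; lra.
split; first exact: MK.
have near0 : \forall y \near x, cst 0 y = phi y.
  have no : continuous (fun x : R => `|x|) by exact: norm_continuous.
  near=> y; rewrite MK//.
  by near: y; exact: cvgr_gt (no x) _ Mx.
by rewrite derive1E -(near_eq_derive _ near0) derive_cst.
Unshelve. all: by end_near. Qed.

Lemma Rintegral_itv_support (h : R -> R) (N : R) :
  (forall x, ~~ (- N < x < N) -> h x = 0) ->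
  \int[mu]_x h x = Int (- N) N h.
Proof.
move=> h0; apply: Rintegral_support => // x _ /=; rewrite in_itv/= => /negP xN.
by apply: h0; apply: contra xN => /andP[/ltW -> /ltW ->].
Qed.

Lemma test_functionM c phi : (forall x, derivable c x 1) ->
  continuous (derive1 c) -> test_function phi ->
  test_function (fun x => c x * phi x) /\
  forall x, derive1 (fun x => c x * phi x) x = c x * derive1 phi x + phi x * derive1 c x.
Proof.
move=> dc cc [dphi cphi kphi].
have D x : derive1 (fun x => c x * phi x) x = c x * derive1 phi x + phi x * derive1 c x.
  by rewrite derive1E (deriveM (dc x) (dphi x)) -!derive1E.
split; last exact: D.
split.
- by move=> x; exact: (derivableM (dc x) (dphi x)).
- rewrite (funext D) => x; apply: cvgD; apply: cvgM.
  + exact: continuous_derivable.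
  + exact: cphi.
  + exact: continuous_derivable.
  + exact: cc.
- apply: subclosed_compact kphi _; first exact: closed_closure.
  apply: closure_subset => x /=; apply: contra_neq => ->; exact: mulr0.
Qed.

(** The product c * phi is again a test function, and c phi' is the difference
    of (c phi)' and c' phi. *)
Lemma is_weak_derivativeM f v c : continuous f -> is_weak_derivative f v ->
  (forall x, derivable c x 1) -> continuous (derive1 c) ->
  is_weak_derivative (fun x => f x * c x) (fun x => v x * c x + f x * derive1 c x).
Proof.
move=> cf [lf lv fv] dc cc.
have c0 : continuous c by exact: continuous_derivable.
split.
- exact: locintM lf c0.
- exact: locintD (locintM lv c0) (locintM lf cc).
move=> phi tphi; have [N N0 phiN] := test_function_support tphi.
have [dphi cphi _] := tphi.
have c1 : continuous phi by exact: continuous_derivable.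
have [tcphi D] := test_functionM dc cc tphi.
have H := fv _ tcphi.
rewrite !(@Rintegral_itv_support _ N) in H *; try
  by move=> x /phiN[p dp]; rewrite ?D ?p ?dp ?mul0r ?mulr0 ?addr0 ?mulr0.
have l1 : locint (fun x => f x * c x * derive1 phi x).
  exact: locintM (locintM lf c0) cphi.
have l2 : locint (fun x => f x * derive1 c x * phi x).
  exact: locintM (locintM lf cc) c1.
have l3 : locint (fun x => v x * c x * phi x).
  exact: locintM (locintM lv c0) c1.
rewrite [in RHS](@eq_Int _ _ _ _ (fun x => v x * c x * phi x + f x * derive1 c x * phi x));
  last by move=> x; rewrite mulrDl.
rewrite (IntD _ _ l3 l2) opprD.
rewrite (@eq_Int _ _ _ _ (fun x => f x * c x * derive1 phi x +
  f x * derive1 c x * phi x)) in H; last by move=> x; rewrite D; ring.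
rewrite (IntD _ _ l1 l2) [in RHS](@eq_Int _ _ _ _ (fun x => v x * c x * phi x)) in H;
  last by move=> x; rewrite mulrA.
by rewrite -H addrK.
Qed.

Lemma is_weak_derivativeD f1 f2 v1 v2 :
  is_weak_derivative f1 v1 -> is_weak_derivative f2 v2 ->
  is_weak_derivative (fun x => f1 x + f2 x) (fun x => v1 x + v2 x).
Proof.
move=> [lf1 lv1 fv1] [lf2 lv2 fv2]; split; [exact: locintD..|].
move=> phi tphi; have [N N0 phiN] := test_function_support tphi.
have [dphi cphi _] := tphi.
have c1 : continuous phi by exact: continuous_derivable.
have H1 := fv1 _ tphi; have H2 := fv2 _ tphi.
rewrite !(@Rintegral_itv_support _ N) in H1 H2 *; try
  by move=> x /phiN[p dp]; rewrite ?p ?dp mulr0.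
rewrite (@eq_Int _ _ _ _ (fun x => f1 x * derive1 phi x + f2 x * derive1 phi x));
  last by move=> x; rewrite mulrDl.
rewrite [in RHS](@eq_Int _ _ _ _ (fun x => v1 x * phi x + v2 x * phi x));
  last by move=> x; rewrite mulrDl.
by rewrite !IntD ?H1 ?H2 ?opprD//; exact: locintM.
Qed.

(** The integral of (f phi)' is a boundary term, and phi vanishes at both
    ends. *)
Lemma is_weak_derivative_derive1 f : (forall x, derivable f x 1) ->
  continuous (derive1 f) -> is_weak_derivative f (derive1 f).
Proof.
move=> df cdf; have cf := continuous_derivable df.
split; [exact: locint_continuous..|].
move=> phi tphi; have [N N0 phiN] := test_function_support tphi.
have [dphi cphi _] := tphi.
have c1 : continuous phi by exact: continuous_derivable.
rewrite !(@Rintegral_itv_support _ N); try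
  by move=> x /phiN[p dp]; rewrite ?p ?dp mulr0.
have [_ D] := test_functionM df cdf tphi.
have lfp := locintM (locint_continuous cf) cphi.
have lpf := locintM (locint_continuous c1) cdf.
have : Int (- N) N (derive1 (fun x => f x * phi x)) = 0.
  rewrite Int_derive1; first last.
  - rewrite (funext D) => x.
    by apply: cvgD; apply: cvgM; [exact: cf|exact: cphi|exact: c1|exact: cdf].
  - by move=> x; exact: (derivableM (df x) (dphi x)).
  - by lra.
  have [|-> _] := phiN N; first by rewrite ltxx andbF.
  have [|-> _] := phiN (- N); first by rewrite ltxx.
  by rewrite !mulr0 subrr.
rewrite (eq_Int _ _ D) (IntD _ _ lfp lpf) => /eqP; rewrite addr_eq0 => /eqP ->.
by congr (- _); apply: eq_Int => x; rewrite mulrC.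
Qed.

(** Both weak derivatives have the same primitive, so Lebesgue's
    differentiation theorem recovers the same function almost everywhere. *)
Lemma weak_derivative_ae_unique f g1 g2 a b : continuous f ->
  is_weak_derivative f g1 -> is_weak_derivative f g2 ->
  {ae mu, forall x, `[a, b]%classic x -> g1 x = g2 x}.
Proof.
move=> cf w1 w2; have [_ l1 _] := w1; have [_ l2 _] := w2.
(* The primitives start at a - 1 because points are recovered strictly to the
   right of the base point. *)
have F1 := @FTC1 R g1 (BLeft (a - 1)) (fun y => locint_itv (a - 1) y l1) l1.
have F2 := @FTC1 R g2 (BLeft (a - 1)) (fun y => locint_itv (a - 1) y l2) l2.
have E : (fun x => Int (a - 1) x g1) = (fun x => Int (a - 1) x g2).
  apply/funext => x; have [ax|xa] := leP (a - 1) x.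
    by rewrite (weak_FTC cf w1)// (weak_FTC cf w2).
  by rewrite set_itv_ge ?bnd_simp -?ltNge// !Rintegral_set0.
apply: filterS2 F1 F2; first exact: (ae_filter_ringOfSetsType mu).
move=> x F1x F2x; rewrite /= in_itv/= => /andP[ax _].
have [|_ <-] := F1x; first by rewrite /= lte_fin; lra.
have [|_ <-] := F2x; first by rewrite /= lte_fin; lra.
by rewrite E.
Qed.

Lemma Int_shift a b (s : R) f : continuous f -> a <= b ->
  Int (a + s) (b + s) f = Int a b (fun x => f (x + s)).
Proof.
move=> cf ab.
have D (x : R) : is_derive x 1 (fun x : R => x + s) 1.
  by apply: is_derive_eq; rewrite addr0.
have dF x : derivable (fun x : R => x + s) x 1 by have [] := D x.
have F' : derive1 (fun x : R => x + s) = cst 1.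
  by apply/funext => x; rewrite derive1E; exact: (@derive_val _ _ _ _ _ _ _ (D x)).
rewrite /Rintegral (@integration_by_substitution_increasing R (fun x => x + s) f)//.
- by congr fine; apply: eq_integral => x _; rewrite F' /= mulr1.
- by move=> x y _ _; rewrite ltrD2r.
- by rewrite F' => x _; exact: cvg_cst.
- by rewrite F'; exact: is_cvg_cst.
- by rewrite F'; exact: is_cvg_cst.
- exact: derivable_LR.
- exact: continuous_subspaceT.
Qed.

Lemma Int_periodic_shift f (T s : R) : continuous f -> periodic f T ->
  0 <= s <= T -> Int 0 T (fun x => f (x + s)) = Int 0 T f.
Proof.
move=> cf pf /andP[s0 sT].
have lf : locint f by exact: locint_continuous.
rewrite -Int_shift//; last by rewrite (le_trans s0).
rewrite add0r (@Int_cat _ s T)//; last by rewrite lerDl.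
have -> : Int T (T + s) f = Int 0 s f.
  rewrite -{1}(add0r T) (addrC T) Int_shift//.
  exact: eq_Int.
by rewrite addrC -Int_cat.
Qed.

End WeakCalculus.

(** * Square integrable functions *)

Section SquareIntegrable.
Context {R : realType}.
Implicit Types (f g c : R -> R) (a b k t s T : R).

Lemma L2_sqr f : L2_loc f -> locint (fun x => f x ^+ 2).
Proof. by case. Qed.

Lemma L2_continuous f : continuous f -> L2_loc f.
Proof.
move=> cf; split; first exact: continuous_measurable_fun.
apply: locint_continuous => x.
by apply: (@continuous_comp _ _ _ f (fun y => y ^+ 2)); [exact: cf|exact: exprn_continuous].
Qed.

Lemma L2_mul f g : L2_loc f -> L2_loc g -> locint (fun x => f x * g x).
Proof.
move=> [mf lf] [mg lg]; apply: (@locint_le _ _ (fun x => f x ^+ 2 + g x ^+ 2)).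
- exact: measurable_funM.
- exact: locintD.
- move=> x; rewrite normrM [leRHS]ger0_norm ?addr_ge0 ?sqr_ge0//.
  rewrite -(real_normK (num_real (f x))) -(real_normK (num_real (g x))).
  have AMGM (u v : R) : 0 <= u -> 0 <= v -> u * v <= u ^+ 2 + v ^+ 2 by nra.
  exact: AMGM.
Qed.

Lemma L2_cst k : L2_loc (fun=> k : R).
Proof. by apply: L2_continuous => x; exact: cvg_cst. Qed.

Lemma L2_locint f : L2_loc f -> locint f.
Proof.
move=> lf; apply: (@locint_ext _ (fun x => f x * 1)).
  by move=> x; rewrite mulr1.
by apply: (L2_mul (g := fun=> 1)) => //; exact: L2_cst.
Qed.

Lemma L2D f g : L2_loc f -> L2_loc g -> L2_loc (fun x => f x + g x).
Proof.
move=> lf lg; have [mf sf] := lf; have [mg sg] := lg; split.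
  exact: measurable_funD.
apply: (@locint_ext _ (fun x => f x ^+ 2 + (f x * g x + f x * g x) + g x ^+ 2)).
  by move=> x; ring.
have fg := L2_mul lf lg.
by apply: locintD => //; apply: locintD => //; apply: locintD.
Qed.

Lemma L2M f c : L2_loc f -> continuous c -> L2_loc (fun x => f x * c x).
Proof.
move=> [mf lf] cc; split.
  by apply: measurable_funM => //; exact: continuous_measurable_fun.
apply: (@locint_ext _ (fun x => f x ^+ 2 * c x ^+ 2)).
  by move=> x; rewrite exprMn.
apply: locintM => // x.
by apply: (@continuous_comp _ _ _ c (fun y => y ^+ 2)); [exact: cc|exact: exprn_continuous].
Qed.

Lemma L2Z k f : L2_loc f -> L2_loc (fun x => k * f x).
Proof.
move=> lf; rewrite (_ : (fun x => k * f x) = (fun x => f x * k)).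
  by apply: (L2M (c := fun=> k)) => // x; exact: cvg_cst.
by apply/funext => x; rewrite mulrC.
Qed.

Lemma L2B f g : L2_loc f -> L2_loc g -> L2_loc (fun x => f x - g x).
Proof.
move=> lf lg; apply: L2D => //.
rewrite (_ : (fun x => - g x) = (fun x => (-1) * g x)); first exact: L2Z.
by apply/funext => x; rewrite mulN1r.
Qed.

(** Pythagoras: constants are orthogonal to functions of mean zero. *)
Lemma Int_sqr_addc f k a b : a <= b -> L2_loc f -> Int a b f = 0 ->
  Int a b (fun x => (f x + k) ^+ 2) =
  Int a b (fun x => f x ^+ 2) + k ^+ 2 * (b - a).
Proof.
move=> ab lf f0; have l1 := L2_locint lf; have [_ l2] := lf.
rewrite (@eq_Int _ _ _ _ (fun x => f x ^+ 2 + ((2 * k) * f x + k ^+ 2))).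
  have lk := @locint_cst R (k ^+ 2).
  rewrite IntD//; last by apply: locintD => //; exact: locintZ.
  by rewrite IntD//; [rewrite IntZ// f0 mulr0 add0r Int_cst|exact: locintZ].
by move=> x; ring.
Qed.

(** The variance of g, that is, the integral of (g - m)^2 for the mean m, is
    nonnegative. *)
Lemma Int_cauchy_schwarz g a b : a <= b -> L2_loc g ->
  Int a b g ^+ 2 <= (b - a) * Int a b (fun x => g x ^+ 2).
Proof.
rewrite le_eqVlt => /predU1P[<- _|ab lg].
  by rewrite set_itv1 !Rintegral_set1 expr0n mulr0.
have ba : 0 < b - a by rewrite subr_gt0.
set m := Int a b g / (b - a).
have lgm : L2_loc (fun x => g x - m) by apply: L2B => //; exact: L2_cst.
have lg1 := L2_locint lg; have lm := @locint_cst R m.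
have g0 : Int a b (fun x => g x - m) = 0.
  by rewrite IntB// Int_cst ?(ltW ab)// divfK ?gt_eqF// subrr.
have := Int_sqr_addc m (ltW ab) lgm g0.
under eq_Int do rewrite subrK.
move=> ->; rewrite mulrDr.
have -> : Int a b g = m * (b - a) by rewrite divfK ?gt_eqF.
rewrite exprMn [in leRHS]mulrCA -expr2 lerDr mulr_ge0 ?(ltW ba)//.
by apply: Int_ge0 => x; exact: sqr_ge0.
Qed.

Lemma le_Int_itv f a b t s : locint f -> (forall x, 0 <= f x) ->
  a <= s -> s <= t -> t <= b -> Int s t f <= Int a b f.
Proof.
move=> lf f0 as_ st tb.
rewrite (@Int_cat _ a s b)// ?(le_trans st)// (@Int_cat _ s t b)//.
have := @Int_ge0 _ a s f f0; have := @Int_ge0 _ t b f f0; lra.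
Qed.

Lemma weak_oscillation f g a b t s : continuous f -> is_weak_derivative f g ->
  L2_loc g -> a <= t <= b -> a <= s <= b ->
  (f t - f s) ^+ 2 <= (b - a) * Int a b (fun x => g x ^+ 2).
Proof.
move=> cf fg lg; wlog st : t s / s <= t => [H tab sab|/andP[at_ tb] /andP[as_ sb]].
  have [st|/ltW ts] := leP s t; first exact: H.
  by rewrite -sqrrN opprB H.
rewrite -(weak_FTC cf fg st) (le_trans (Int_cauchy_schwarz st lg))//.
have lg2 := L2_sqr lg.
have H := @le_Int_itv _ a b t s lg2 (fun x => sqr_ge0 _) as_ st tb.
have H0 : 0 <= Int s t (fun x => g x ^+ 2) by apply: Int_ge0 => x; exact: sqr_ge0.
by apply: ler_pM => //; rewrite ?subr_ge0//; lra.
Qed.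

(** With N the bound on the oscillation, f t - N <= f s <= f t + N for all s;
    averaging over s gives `|f t| <= N, since f has mean zero. *)
Lemma poincare f g a b t : a < b -> continuous f -> is_weak_derivative f g ->
  L2_loc g -> Int a b f = 0 -> a <= t <= b ->
  f t ^+ 2 <= (b - a) * Int a b (fun x => g x ^+ 2).
Proof.
move=> ab cf fg lg f0 tab.
set I := _ * _.
have I0 : 0 <= I.
  by rewrite mulr_ge0 ?subr_ge0 ?(ltW ab)//; apply: Int_ge0 => x; exact: sqr_ge0.
have lf : locint f by exact: locint_continuous.
have osc s : a <= s <= b -> `|f t - f s| <= Num.sqrt I.
  move=> sab; rewrite -sqrtr_sqr ler_wsqrtr//; exact: weak_oscillation.
have b1 : f t - Num.sqrt I <= 0.
  rewrite -(@pmulr_rle0 _ (b - a)) ?subr_gt0// mulrC.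
  rewrite -Int_cst ?(ltW ab)// -[leRHS]f0.
  apply: le_Int => //; first exact: locint_cst.
  by move=> s /osc; rewrite ler_norml => /andP[? ?]; lra.
have b2 : 0 <= f t + Num.sqrt I.
  rewrite -(@pmulr_rge0 _ (b - a)) ?subr_gt0// mulrC.
  rewrite -Int_cst ?(ltW ab)// -[leLHS]f0.
  apply: le_Int => //; first exact: locint_cst.
  by move=> s /osc; rewrite ler_norml => /andP[? ?]; lra.
rewrite -(sqr_sqrtr I0) -(real_normK (num_real (f t))) ler_sqr ?nnegrE ?sqrtr_ge0//.
by rewrite ler_norml; apply/andP; split; lra.
Qed.

Lemma periodic_floor (V : Type) (f : R -> V) T t : 0 < T ->
  (forall u, f (u + T) = f u) -> exists2 s, 0 <= s <= T & f t = f s.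
Proof.
move=> T0 fT.
have fn n u : f (u + n%:R * T) = f u.
  elim: n => [|n IH]; first by rewrite mul0r addr0.
  by rewrite -natr1 mulrDl mul1r addrA fT.
have fz (z : int) u : f (u + z%:~R * T) = f u.
  case: z => n; first exact: fn.
  by rewrite NegzE mulrNz mulNr -(fn n.+1) subrK.
exists (t - (Num.floor (t / T))%:~R * T).
  have /andP[fl fu] := floor_itv (t / T).
  rewrite subr_ge0 -ler_pdivlMr// fl/= lerBlDr -[X in X + _]mul1r -mulrDl.
  by rewrite -ler_pdivrMr// addrC -intrD1 ltW.
by rewrite -(fz (Num.floor (t / T)) (t - _)) subrK.
Qed.

End SquareIntegrable.

(** * The quadratic inequality in real coordinates *)

Section QuadraticInequality.
Context {R : realType}.
Implicit Types (f g p q : R -> R).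

Lemma is_weak_derivative_addc f g (k : R) : is_weak_derivative f g ->
  is_weak_derivative (fun x => f x + k) g.
Proof.
move=> fg.
have k' : derive1 (cst k : R -> R) = cst 0.
  by apply/funext => x; rewrite derive1E derive_cst.
have wk : is_weak_derivative (cst k : R -> R) (cst 0).
  rewrite -k'; apply: is_weak_derivative_derive1.
    by move=> x; exact: derivable_cst.
  by rewrite k' => x; exact: cvg_cst.
have := is_weak_derivativeD fg wk.
by rewrite [X in is_weak_derivative _ X](_ : _ = g)//; apply/funext => x; rewrite addr0.
Qed.

Lemma continuous_shift f (s : R) : continuous f -> continuous (fun x => f (x + s)).
Proof.
move=> cf x; apply: (@continuous_comp _ _ _ (fun x => x + s) f); last exact: cf.
by apply: cvgD; [exact: cvg_id|exact: cvg_cst].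
Qed.

Section Period.
Variables (T : R).
Hypothesis T0 : 0 < T.

Lemma periodic_poincare f g t : continuous f -> periodic f T ->
  is_weak_derivative f g -> L2_loc g -> Int 0 T f = 0 ->
  f t ^+ 2 <= T * Int 0 T (fun x => g x ^+ 2).
Proof.
move=> cf pf fg lg f0; have [s sT ->] := periodic_floor t T0 pf.
by have := poincare T0 cf fg lg f0 sT; rewrite subr0.
Qed.

Lemma periodic_oscillation f g t s : continuous f -> periodic f T ->
  is_weak_derivative f g -> L2_loc g ->
  (f t - f s) ^+ 2 <= T * Int 0 T (fun x => g x ^+ 2).
Proof.
move=> cf pf fg lg; have [u uT ->] := periodic_floor t T0 pf.
have [w wT ->] := periodic_floor s T0 pf.
by have := weak_oscillation cf fg lg uT wT; rewrite subr0.
Qed.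

(** Each difference is bounded by the oscillation of f.  The constant T^2 lost in
    this way is absorbed by the small factor delta^2. *)
Lemma scalar_difference_le f g (delta : R) (n : nat) (kap s : nat -> R) :
  continuous f -> periodic f T -> is_weak_derivative f g -> L2_loc g ->
  (forall h, 0 <= kap h) ->
  delta ^+ 2 * (\sum_(1 <= h < n) kap h) * T ^+ 2 <= 1 ->
  delta ^+ 2 * (\sum_(1 <= h < n)
    kap h * Int 0 T (fun t => (f t - f (t + s h)) ^+ 2)) <=
  Int 0 T (fun t => g t ^+ 2).
Proof.
move=> cf pf fg lg kap0 small; set I := Int 0 T (fun t => g t ^+ 2).
have I0 : 0 <= I by apply: Int_ge0 => t; exact: sqr_ge0.
have H h : Int 0 T (fun t => (f t - f (t + s h)) ^+ 2) <= T ^+ 2 * I.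
  have -> : T ^+ 2 * I = (T * I) * (T - 0) by ring.
  rewrite -Int_cst; last exact: ltW.
  apply: le_Int => [||t _]; [|exact: locint_cst|exact: periodic_oscillation].
  apply: L2_sqr; apply: L2_continuous => x.
  by apply: cvgB; [exact: cf|exact: continuous_shift].
apply: (@le_trans _ _ (delta ^+ 2 * (\sum_(1 <= h < n) kap h * (T ^+ 2 * I)))).
  rewrite ler_wpM2l ?sqr_ge0//; apply: ler_sum => h _.
  by rewrite ler_wpM2l.
rewrite -mulr_suml -[leRHS]mul1r; apply: le_trans (ler_wpM2r I0 small).
by rewrite !mulrA.
Qed.

Variables (p1 p2 q1 q2 : R -> R).
Hypotheses (cp1 : continuous p1) (cp2 : continuous p2).
Hypotheses (pp1 : periodic p1 T) (pp2 : periodic p2 T).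
Hypotheses (pq1 : is_weak_derivative p1 q1) (pq2 : is_weak_derivative p2 q2).
Hypotheses (lq1 : L2_loc q1) (lq2 : L2_loc q2).

Let m1 := Int 0 T p1 / T.
Let m2 := Int 0 T p2 / T.
Let f1 t := p1 t - m1.
Let f2 t := p2 t - m2.
Let B := Int 0 T (fun t => q1 t ^+ 2) + Int 0 T (fun t => q2 t ^+ 2).

Lemma mean_centered p : continuous p -> Int 0 T (fun t => p t - Int 0 T p / T) = 0.
Proof.
move=> cp; rewrite IntB; [|exact: locint_continuous|exact: locint_cst].
by rewrite Int_cst ?(ltW T0)// subr0 divfK ?gt_eqF// subrr.
Qed.

Let cf1 : continuous f1.
Proof. by move=> x; apply: cvgB; [exact: cp1|exact: cvg_cst]. Qed.

Let cf2 : continuous f2.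
Proof. by move=> x; apply: cvgB; [exact: cp2|exact: cvg_cst]. Qed.

Let pf1 : periodic f1 T.
Proof. by move=> x; rewrite /f1 pp1. Qed.

Let pf2 : periodic f2 T.
Proof. by move=> x; rewrite /f2 pp2. Qed.

Let f10 : Int 0 T f1 = 0.
Proof. exact: mean_centered. Qed.

Let f20 : Int 0 T f2 = 0.
Proof. exact: mean_centered. Qed.

Let bound1 t : f1 t ^+ 2 <= T * Int 0 T (fun t => q1 t ^+ 2).
Proof.
exact: (periodic_poincare t cf1 pf1 (is_weak_derivative_addc _ pq1) lq1 f10).
Qed.

Let bound2 t : f2 t ^+ 2 <= T * Int 0 T (fun t => q2 t ^+ 2).
Proof.
exact: (periodic_poincare t cf2 pf2 (is_weak_derivative_addc _ pq2) lq2 f20).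
Qed.

Let B0 : 0 <= B.
Proof. by apply: addr_ge0; apply: Int_ge0 => t; exact: sqr_ge0. Qed.

(** The constant d * m is orthogonal to q + d * f, which has mean zero. *)
Let kinetic_component (q f : R -> R) (c d m : R) : continuous f ->
  L2_loc q -> Int 0 T q = 0 -> Int 0 T f = 0 -> (forall t, f t ^+ 2 <= T * c) ->
  2^-1 * Int 0 T (fun t => q t ^+ 2) - d ^+ 2 * T ^+ 2 * c + d ^+ 2 * T * m ^+ 2 <=
  Int 0 T (fun t => (q t + d * (f t + m)) ^+ 2).
Proof.
move=> cf lq q0 f0 fb.
have lf : L2_loc f by exact: L2_continuous.
have ldf : L2_loc (fun t => d * f t) by exact: L2Z.
rewrite [leRHS](@eq_Int _ _ _ _ (fun t => ((q t + d * f t) + d * m) ^+ 2)); last first.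
  by move=> t; rewrite mulrDr addrA.
rewrite [leRHS]Int_sqr_addc; last first.
- by rewrite IntD ?IntZ ?q0 ?f0 ?mulr0 ?addr0//; exact: L2_locint.
- exact: L2D.
- exact: ltW.
have -> : (d * m) ^+ 2 * (T - 0) = d ^+ 2 * T * m ^+ 2 by ring.
rewrite lerD2r.
have -> : d ^+ 2 * T ^+ 2 * c = (d ^+ 2 * (T * c)) * (T - 0) by ring.
have l1 : locint (fun t => 2^-1 * q t ^+ 2) by apply: locintZ; exact: L2_sqr.
have l2 := @locint_cst R (d ^+ 2 * (T * c)).
rewrite -IntZ; last exact: L2_sqr.
rewrite -Int_cst; last exact: ltW.
rewrite -IntB//; apply: le_Int; first exact: locintB.
  by apply: L2_sqr; exact: L2D.
move=> t _; have := fb t; have d2 := sqr_ge0 d.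
move: (f t) (q t) (T * c) => x y A xA.
have : d ^+ 2 * x ^+ 2 <= d ^+ 2 * A by rewrite ler_wpM2l.
(* (y + d x)^2 = (y + 2 d x)^2 / 2 + y^2 / 2 - (d x)^2 *)
have := sqr_ge0 (y + 2 * (d * x)); nra.
Qed.

Let periodic_zero_mean (p q : R -> R) : continuous p -> periodic p T ->
  is_weak_derivative p q -> Int 0 T q = 0.
Proof.
move=> cp pp pq; rewrite (weak_FTC cp pq (ltW T0)).
by rewrite -{1}(add0r T) pp subrr.
Qed.

Let kinetic_ge (delta : R) :
  (2^-1 - delta ^+ 2 * T ^+ 2) * B + delta ^+ 2 * T * (m1 ^+ 2 + m2 ^+ 2) <=
  Int 0 T (fun t => (q1 t - delta * p2 t) ^+ 2) +
  Int 0 T (fun t => (q2 t + delta * p1 t) ^+ 2).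
Proof.
have K1 := @kinetic_component q1 f2 _ (- delta) m2 cf2 lq1
  (periodic_zero_mean cp1 pp1 pq1) f20 bound2.
have K2 := @kinetic_component q2 f1 _ delta m1 cf1 lq2
  (periodic_zero_mean cp2 pp2 pq2) f10 bound1.
rewrite [X in _ <= X + _](@eq_Int _ _ _ _ (fun t => (q1 t + - delta * (f2 t + m2)) ^+ 2)); last first.
  by move=> t; rewrite /f2 subrK mulNr.
rewrite [X in _ <= _ + X](@eq_Int _ _ _ _ (fun t => (q2 t + delta * (f1 t + m1)) ^+ 2)); last first.
  by move=> t; rewrite /f1 subrK.
rewrite sqrrN in K1; apply: le_trans (lerD K1 K2).
by rewrite le_eqVlt; apply/orP; left; apply/eqP; rewrite /B; ring.
Qed.

Let difference_component (g1 g2 g3 : R -> R) (a b s m : R) :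
  continuous g1 -> continuous g2 -> continuous g3 -> periodic g2 T -> periodic g3 T ->
  Int 0 T g1 = 0 -> Int 0 T g2 = 0 -> Int 0 T g3 = 0 -> 0 <= s <= T ->
  Int 0 T (fun t => (g1 t - (a * g2 (t + s) + b * g3 (t + s)) + m) ^+ 2) =
  Int 0 T (fun t => (g1 t - (a * g2 (t + s) + b * g3 (t + s))) ^+ 2) + m ^+ 2 * T.
Proof.
move=> c1 c2 c3 p_2 p_3 z1 z2 z3 sT.
have c2s : continuous (fun x => g2 (x + s)) by exact: continuous_shift.
have c3s : continuous (fun x => g3 (x + s)) by exact: continuous_shift.
have l2 := L2Z a (L2_continuous c2s); have l3 := L2Z b (L2_continuous c3s).
have l1 := L2_continuous c1; have l23 := L2D l2 l3.
rewrite Int_sqr_addc ?subr0//; [exact: ltW|exact: L2B|].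
rewrite IntB; [|exact: L2_locint..].
rewrite IntD; [|exact: L2_locint..].
rewrite !IntZ; [|exact: locint_continuous..].
by rewrite !Int_periodic_shift// z1 z2 z3 !mulr0 addr0 subrr.
Qed.

(** With R the rotation of cosine c and sine s, Pythagoras separates m - R m,
    and `|f - R f'|^2 <= 2 `|f|^2 + 2 `|f'|^2 is bounded pointwise by the Poincare
    inequality. *)
Let difference_le (c s sh : R) : c ^+ 2 + s ^+ 2 = 1 -> 0 <= sh <= T ->
  Int 0 T (fun t => (p1 t - (c * p1 (t + sh) + s * p2 (t + sh))) ^+ 2) +
  Int 0 T (fun t => (p2 t - (c * p2 (t + sh) + (- s) * p1 (t + sh))) ^+ 2) <=
  4 * T ^+ 2 * B + ((1 - c) ^+ 2 + s ^+ 2) * T * (m1 ^+ 2 + m2 ^+ 2).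
Proof.
move=> cs shT.
rewrite [X in X + _](@eq_Int _ _ _ _ (fun t => (f1 t - (c * f1 (t + sh) + s * f2 (t + sh)) +
  (m1 - (c * m1 + s * m2))) ^+ 2)); last by move=> t; rewrite /f1 /f2; ring.
rewrite [X in _ + X <= _](@eq_Int _ _ _ _ (fun t => (f2 t - (c * f2 (t + sh) + (- s) * f1 (t + sh)) +
  (m2 - (c * m2 + (- s) * m1))) ^+ 2)); last by move=> t; rewrite /f1 /f2; ring.
rewrite (difference_component _ _ _ cf1 cf1 cf2 pf1 pf2 f10 f10 f20 shT).
rewrite (difference_component _ _ _ cf2 cf2 cf1 pf2 pf1 f20 f20 f10 shT).
rewrite addrACA; have -> : (m1 - (c * m1 + s * m2)) ^+ 2 * T +
   (m2 - (c * m2 + - s * m1)) ^+ 2 * T =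
   ((1 - c) ^+ 2 + s ^+ 2) * T * (m1 ^+ 2 + m2 ^+ 2) by ring.
rewrite lerD2r.
have l2 (g : R -> R) : continuous g -> L2_loc (fun t => g (t + sh)).
  by move=> cg; apply: L2_continuous; exact: continuous_shift.
have L1 : L2_loc (fun t => f1 t - (c * f1 (t + sh) + s * f2 (t + sh))).
  by apply: L2B; [exact: L2_continuous|apply: L2D; apply: L2Z; exact: l2].
have L2 : L2_loc (fun t => f2 t - (c * f2 (t + sh) + (- s) * f1 (t + sh))).
  by apply: L2B; [exact: L2_continuous|apply: L2D; apply: L2Z; exact: l2].
rewrite -IntD; [|exact: L2_sqr..].
have -> : 4 * T ^+ 2 * B = 4 * (T * B) * (T - 0) by ring.
rewrite -Int_cst; last exact: ltW.
apply: le_Int; [by apply: locintD; exact: L2_sqr|exact: locint_cst|].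
move=> t _.
have : f1 t ^+ 2 + f2 t ^+ 2 <= T * B by rewrite /B mulrDr; exact: lerD.
have : f1 (t + sh) ^+ 2 + f2 (t + sh) ^+ 2 <= T * B by rewrite /B mulrDr; exact: lerD.
move: (f1 t) (f2 t) (f1 (t + sh)) (f2 (t + sh)) (T * B) => x y x' y' A A1 A2.
have E : (c * x' + s * y') ^+ 2 + (c * y' + - s * x') ^+ 2 = x' ^+ 2 + y' ^+ 2.
  by rewrite -[RHS]mul1r -cs; ring.
move: (c * x' + s * y') (c * y' + - s * x') E => X Y E.
(* the rotation preserves x'^2 + y'^2, and (x - X)^2 <= 2 x^2 + 2 X^2 *)
have := sqr_ge0 (x + X); have := sqr_ge0 (y + Y); nra.
Qed.

(** In the frame where the circle is at rest the loop splits into its mean and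
    a part of mean zero.  The two are orthogonal for both sides; on the mean
    both sides agree, and on the other part the left side is of size delta^2
    while the right side controls a fixed fraction of the square norm of the
    derivative. *)
Lemma planar_difference_le (delta : R) (n : nat) (kap c s sh : nat -> R) :
  (forall h, 0 <= kap h) -> (forall h, c h ^+ 2 + s h ^+ 2 = 1) ->
  (forall h, (1 <= h < n)%N -> 0 <= sh h <= T) ->
  \sum_(1 <= h < n) kap h * ((1 - c h) ^+ 2 + s h ^+ 2) = 1 ->
  delta ^+ 2 * (1 + 4 * \sum_(1 <= h < n) kap h) * T ^+ 2 <= 2^-1 ->
  delta ^+ 2 * (\sum_(1 <= h < n) kap h *
    (Int 0 T (fun t => (p1 t - (c h * p1 (t + sh h) + s h * p2 (t + sh h))) ^+ 2) +
     Int 0 T (fun t => (p2 t - (c h * p2 (t + sh h) + (- s h) * p1 (t + sh h))) ^+ 2))) <=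
  Int 0 T (fun t => (q1 t - delta * p2 t) ^+ 2) +
  Int 0 T (fun t => (q2 t + delta * p1 t) ^+ 2).
Proof.
move=> kap0 cs shT norm1 small.
apply: le_trans (kinetic_ge delta).
set K := \sum_(1 <= h < n) kap h in small.
set M := m1 ^+ 2 + m2 ^+ 2.
apply: (@le_trans _ _ (delta ^+ 2 * (4 * T ^+ 2 * B * K + T * M))).
  rewrite ler_wpM2l ?sqr_ge0//.
  rewrite -[T * M]mulr1 -[X in T * M * X]norm1 /K !mulr_sumr -big_split/=.
  rewrite big_nat [leRHS]big_nat; apply: ler_sum => h hn.
  apply: le_trans (ler_wpM2l (kap0 h) (difference_le (cs h) (shT h hn))) _.
  by rewrite le_eqVlt; apply/orP; left; apply/eqP; rewrite /M; ring.
have := ler_wpM2r B0 small; nra.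
Qed.

End Period.
End QuadraticInequality.

(** * Passing to the frame of the circle *)

Section RotatingFrame.
Context {R : realType}.
Implicit Types (a b : R -> R).

Lemma is_derive_cosZ (k t : R) :
  is_derive t 1 (fun t : R => cos (k * t)) (- (k * sin (k * t))).
Proof.
have d1 : is_derive t 1 (fun x : R => k * x) k.
  by apply: is_derive_eq; rewrite /GRing.scale/= mulr1.
have := @is_derive1_comp R cos (fun x => k * x) t _ _ (is_derive_cos _) d1.
by rewrite mulNr mulrC.
Qed.

Lemma is_derive_sinZ (k t : R) :
  is_derive t 1 (fun t : R => sin (k * t)) (k * cos (k * t)).
Proof.
have d1 : is_derive t 1 (fun x : R => k * x) k.
  by apply: is_derive_eq; rewrite /GRing.scale/= mulr1.
have := @is_derive1_comp R sin (fun x => k * x) t _ _ (is_derive_sin _) d1.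
by rewrite mulrC.
Qed.

Lemma derivable_cosZ (k t : R) : derivable (fun t : R => cos (k * t)) t 1.
Proof. by have [] := is_derive_cosZ k t. Qed.

Lemma derivable_sinZ (k t : R) : derivable (fun t : R => sin (k * t)) t 1.
Proof. by have [] := is_derive_sinZ k t. Qed.

Lemma derive1_cosZ (k : R) :
  derive1 (fun t : R => cos (k * t)) = fun t => - (k * sin (k * t)).
Proof.
apply/funext => t; rewrite derive1E.
exact: (@derive_val _ _ _ _ _ _ _ (is_derive_cosZ k t)).
Qed.

Lemma derive1_sinZ (k : R) :
  derive1 (fun t : R => sin (k * t)) = fun t => k * cos (k * t).
Proof.
apply/funext => t; rewrite derive1E.
exact: (@derive_val _ _ _ _ _ _ _ (is_derive_sinZ k t)).
Qed.

Lemma continuous_cosZ (k : R) : continuous (fun t : R => cos (k * t)).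
Proof. by apply: continuous_derivable => t; exact: derivable_cosZ. Qed.

Lemma continuous_sinZ (k : R) : continuous (fun t : R => sin (k * t)).
Proof. by apply: continuous_derivable => t; exact: derivable_sinZ. Qed.

Lemma cos_nat_periodic (k : nat) (t : R) :
  cos (k%:R * (t + 2 * pi)) = cos (k%:R * t).
Proof.
rewrite mulrDr [X in _ + X](_ : _ = (pi *+ 2) *+ k); last first.
  by rewrite -[RHS]mulr_natl -[pi *+ 2]mulr_natl.
by rewrite (periodicn (@cosD2pi R)).
Qed.

Lemma sin_nat_periodic (k : nat) (t : R) :
  sin (k%:R * (t + 2 * pi)) = sin (k%:R * t).
Proof.
rewrite mulrDr [X in _ + X](_ : _ = (pi *+ 2) *+ k); last first.
  by rewrite -[RHS]mulr_natl -[pi *+ 2]mulr_natl.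
by rewrite (periodicn (@sinD2pi R)).
Qed.

Lemma two_pi_gt0 : 0 < 2 * pi :> R.
Proof. by rewrite mulr_gt0// pi_gt0. Qed.

(** With z = z0 + i z1 this is the real form of the passage to exp(i k t) z,
    which turns the operator d/dt + i omega into d/dt + i (omega - k). *)
Lemma planar_kinetic_ge (z0 z1 v0 v1 : R -> R) (k n : nat) (omega : R)
    (kap : nat -> R) :
  continuous z0 -> continuous z1 -> periodic z0 (2 * pi) -> periodic z1 (2 * pi) ->
  is_weak_derivative z0 v0 -> is_weak_derivative z1 v1 ->
  L2_loc v0 -> L2_loc v1 ->
  (0 < n)%N -> (forall h, 0 <= kap h) ->
  \sum_(1 <= h < n) kap h * ((1 - cos (k%:R * (h%:R * tau R n))) ^+ 2 +
      sin (k%:R * (h%:R * tau R n)) ^+ 2) = 1 ->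
  (omega - k%:R) ^+ 2 * (1 + 4 * \sum_(1 <= h < n) kap h) * (2 * pi) ^+ 2 <= 2^-1 ->
  (omega - k%:R) ^+ 2 * (\sum_(1 <= h < n) kap h *
    Int 0 (2 * pi) (fun t => (z0 t - z0 (t + h%:R * tau R n)) ^+ 2 +
                             (z1 t - z1 (t + h%:R * tau R n)) ^+ 2)) <=
  Int 0 (2 * pi) (fun t => (v0 t - omega * z1 t) ^+ 2 + (v1 t + omega * z0 t) ^+ 2).
Proof.
move=> c0 c1 pz0 pz1 w0 w1 l0 l1 n0 kap0 norm1 small.
pose C t : R := cos (k%:R * t); pose S t : R := sin (k%:R * t).
have CS t : C t ^+ 2 + S t ^+ 2 = 1 by exact: cos2Dsin2.
have cC : continuous C by exact: continuous_cosZ.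
have cS : continuous S by exact: continuous_sinZ.
pose p1 t := z0 t * C t + z1 t * (- S t).
pose p2 t := z0 t * S t + z1 t * C t.
(* q1 and q2 are the weak derivatives given by the product rule *)
pose q1 t := (v0 t * C t + z0 t * (- (k%:R * S t))) + (v1 t * (- S t) + z1 t * (- (k%:R * C t))).
pose q2 t := (v0 t * S t + z0 t * (k%:R * C t)) + (v1 t * C t + z1 t * (- (k%:R * S t))).
have cNS : continuous (fun t => - S t) by move=> t; apply: cvgN; exact: cS.
have ckC : continuous (fun t => k%:R * C t).
  by move=> t; apply: cvgM; [exact: cvg_cst|exact: cC].
have ckS : continuous (fun t => k%:R * S t).
  by move=> t; apply: cvgM; [exact: cvg_cst|exact: cS].
have cNkC : continuous (fun t => - (k%:R * C t)) by move=> t; apply: cvgN; exact: ckC.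
have cNkS : continuous (fun t => - (k%:R * S t)) by move=> t; apply: cvgN; exact: ckS.
have dNS t : derivable (fun t => - S t) t 1.
  by apply: derivableN; exact: derivable_sinZ.
have dNS1 : derive1 (fun t => - S t) = fun t => - (k%:R * C t).
  apply/funext => t; rewrite derive1E deriveN; last exact: derivable_sinZ.
  by rewrite -derive1E derive1_sinZ.
have wM (f v c c' : R -> R) : continuous f -> is_weak_derivative f v ->
    (forall x, derivable c x 1) -> derive1 c = c' -> continuous c' ->
    is_weak_derivative (fun x => f x * c x) (fun x => v x * c x + f x * c' x).
  by move=> cf fv dc <- cc'; exact: is_weak_derivativeM.
have dC t : derivable C t 1 by exact: derivable_cosZ.
have dS t : derivable S t 1 by exact: derivable_sinZ.
have C1 : derive1 C = fun t => - (k%:R * S t) by exact: derive1_cosZ.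
have S1 : derive1 S = fun t => k%:R * C t by exact: derive1_sinZ.
have wp1 : is_weak_derivative p1 q1.
  exact: is_weak_derivativeD (wM _ _ _ _ c0 w0 dC C1 cNkS) (wM _ _ _ _ c1 w1 dNS dNS1 cNkC).
have wp2 : is_weak_derivative p2 q2.
  exact: is_weak_derivativeD (wM _ _ _ _ c0 w0 dS S1 ckC) (wM _ _ _ _ c1 w1 dC C1 cNkS).
have lz0 := L2_continuous c0; have lz1 := L2_continuous c1.
have lq1 : L2_loc q1 by apply: L2D; apply: L2D; exact: L2M.
have lq2 : L2_loc q2 by apply: L2D; apply: L2D; exact: L2M.
have cp1 : continuous p1.
  by move=> t; apply: cvgD; apply: cvgM; [exact: c0|exact: cC|exact: c1|exact: cNS].
have cp2 : continuous p2.
  by move=> t; apply: cvgD; apply: cvgM; [exact: c0|exact: cS|exact: c1|exact: cC].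
have pC t : C (t + 2 * pi) = C t by exact: cos_nat_periodic.
have pS t : S (t + 2 * pi) = S t by exact: sin_nat_periodic.
have pp1 : periodic p1 (2 * pi) by move=> t; rewrite /p1 pz0 pz1 pC pS.
have pp2 : periodic p2 (2 * pi) by move=> t; rewrite /p2 pz0 pz1 pC pS.
pose s h : R := h%:R * tau R n.
have s_itv h : (1 <= h < n)%N -> 0 <= s h <= 2 * pi.
  move=> /andP[_ hn]; have n0' : 0 < n%:R :> R by rewrite ltr0n.
  have pi0 := ltW two_pi_gt0.
  rewrite /s /tau mulr_ge0 ?divr_ge0//=.
  by rewrite mulrCA ler_piMr// ler_pdivrMr// mul1r ler_nat ltnW.
have := @planar_difference_le R _ two_pi_gt0 p1 p2 q1 q2 cp1 cp2 pp1 pp2 wp1 wp2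
  lq1 lq2 (omega - k%:R) n kap (fun h => C (s h)) (fun h => S (s h)) s kap0
  (fun h => CS _) s_itv norm1 small.
have lp1 := L2_continuous cp1; have lp2 := L2_continuous cp2.
rewrite -IntD; last 2 first.
- by apply: L2_sqr; apply: L2B => //; exact: L2Z.
- by apply: L2_sqr; apply: L2D => //; exact: L2Z.
rewrite [leRHS](@eq_Int _ _ _ _ (fun t => (v0 t - omega * z1 t) ^+ 2 + (v1 t + omega * z0 t) ^+ 2)); last first.
  move=> t; rewrite -[RHS]mul1r -[X in _ = X * _](CS t) /q1 /q2 /p1 /p2.
  move: (C t) (S t) (z0 t) (z1 t) (v0 t) (v1 t) => x y a b c d; ring.
apply: le_trans; rewrite le_eqVlt; apply/orP; left; apply/eqP.
congr (_ * _); apply: eq_big_nat => h hn; congr (_ * _).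
have csh (g : R -> R) : continuous g -> L2_loc (fun t => g (t + s h)).
  by move=> cg; apply: L2_continuous; exact: continuous_shift.
rewrite -IntD; last 2 first.
- by apply: L2_sqr; apply: L2B => //; apply: L2D; apply: L2Z; exact: csh.
- by apply: L2_sqr; apply: L2B => //; apply: L2D; apply: L2Z; exact: csh.
apply: eq_Int => t; rewrite -/(s h).
have Ct : C (t + s h) = C t * C (s h) - S t * S (s h) by rewrite /C /S mulrDr cosD.
have St : S (t + s h) = S t * C (s h) + C t * S (s h) by rewrite /C /S mulrDr sinD.
have E1 : C (s h) * p1 (t + s h) + S (s h) * p2 (t + s h) =
    z0 (t + s h) * C t + z1 (t + s h) * (- S t).
  rewrite /p1 /p2 Ct St.
  have -> : z0 (t + s h) * C t + z1 (t + s h) * (- S t) =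
    (C (s h) ^+ 2 + S (s h) ^+ 2) * (z0 (t + s h) * C t + z1 (t + s h) * (- S t)).
    by rewrite CS mul1r.
  ring.
have E2 : C (s h) * p2 (t + s h) + (- S (s h)) * p1 (t + s h) =
    z0 (t + s h) * S t + z1 (t + s h) * C t.
  rewrite /p1 /p2 Ct St.
  have -> : z0 (t + s h) * S t + z1 (t + s h) * C t =
    (C (s h) ^+ 2 + S (s h) ^+ 2) * (z0 (t + s h) * S t + z1 (t + s h) * C t).
    by rewrite CS mul1r.
  ring.
rewrite E1 E2 /p1 /p2 -[LHS]mul1r -[X in X * _ = _](CS t).
ring.
Qed.

End RotatingFrame.

(** * Coordinates along and across the rotating plane *)

Section EuclideanCoordinates.
Context {R : realType}.

Lemma Int_sum (I : Type) (r : seq I) (F : I -> R -> R) (a b : R) :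
  (forall i, locint (F i)) ->
  locint (fun t => \sum_(i <- r) F i t) /\
  Int a b (fun t => \sum_(i <- r) F i t) = \sum_(i <- r) Int a b (F i).
Proof.
move=> lF; elim: r => [|i r [l E]].
  have E0 : (fun t : R => \sum_(i <- [::]) F i t) = fun=> 0.
    by apply/funext => t; rewrite big_nil.
  rewrite E0 big_nil; split; first exact: locint_cst.
  by rewrite Rintegral_cst// mul0r.
have Ei : (fun t : R => \sum_(j <- i :: r) F j t) =
    fun t => F i t + \sum_(j <- r) F j t.
  by apply/funext => t; rewrite big_cons.
by rewrite Ei big_cons IntD// E; split => //; exact: locintD.
Qed.

Lemma integral_Int (f : R -> R) (a b : R) : locint f ->
  (\int[lebesgue_measure]_(t in `[a, b]) (f t)%:E = (Int a b f)%:E)%E.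
Proof.
by move=> lf; rewrite fineK//; apply: integrable_fin_num => //; exact: locint_itv.
Qed.

Lemma edot_ge0 d (u : 'rV[R]_d) : 0 <= edot u u.
Proof. by apply: sumr_ge0 => j _; rewrite -expr2 sqr_ge0. Qed.

Lemma enorm_ge0 d (u : 'rV[R]_d) : 0 <= enorm u.
Proof. exact: sqrtr_ge0. Qed.

Lemma enorm_sqr d (u : 'rV[R]_d) : enorm u ^+ 2 = edot u u.
Proof. by rewrite sqr_sqrtr ?edot_ge0. Qed.

Lemma enorm_gt0 d (u : 'rV[R]_d) : u != 0 -> 0 < enorm u.
Proof.
move=> u0; rewrite lt_def enorm_ge0 andbT; apply: contra_neq u0 => eu.
have /eqP : edot u u = 0 by rewrite -enorm_sqr eu expr0n.
rewrite /edot psumr_eq0 => [/allP uj|j _]; last by rewrite -expr2 sqr_ge0.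
apply/rowP => j; have := uj j (mem_index_enum _).
by rewrite -expr2 sqrf_eq0 mxE => /eqP.
Qed.

Variable d : nat.
Implicit Types (u : 'rV[R]_d.+2) (z v : R -> 'rV[R]_d.+2).

Definition i0 : 'I_d.+2 := ord0.
Definition i1 : 'I_d.+2 := lift ord0 ord0.
Definition i2 (j : 'I_d) : 'I_d.+2 := lift ord0 (lift ord0 j).

Lemma edot_split u :
  edot u u = u 0 i0 ^+ 2 + u 0 i1 ^+ 2 + \sum_(j < d) u 0 (i2 j) ^+ 2.
Proof.
by rewrite /edot !big_ord_recl addrA -!expr2.
Qed.

Lemma J_coord0 u : J u 0 i0 = - u 0 i1.
Proof.
rewrite /J mxE !big_ord_recl big1 => [|j _]; rewrite !mxE/=; last by rewrite mulr0.
by rewrite mulr0 add0r addr0 mulrN1.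
Qed.

Lemma J_coord1 u : J u 0 i1 = u 0 i0.
Proof.
rewrite /J mxE !big_ord_recl big1 => [|j _]; rewrite !mxE/=; last by rewrite mulr0.
by rewrite mulr1 mulr0 !addr0.
Qed.

Lemma J_coord2 u j : J u 0 (i2 j) = 0.
Proof.
rewrite /J mxE big1 // => i _; by rewrite !mxE/= !andbF mulr0.
Qed.

Lemma continuous_coord z (j : 'I_d.+2) : continuous z ->
  continuous (fun t => z t 0 j).
Proof.
move=> cz t; apply: (@continuous_comp _ _ _ z (fun u : 'rV[R]_d.+2 => u 0 j)).
  exact: cz.
exact: coord_continuous.
Qed.

Lemma locint_edot z : (forall j, L2_loc (fun t => z t 0 j)) ->
  locint (fun t => edot (z t) (z t)).
Proof.
move=> lz; apply: (Int_sum _ 0 0 _).1 => j.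
exact: L2_mul.
Qed.

Lemma L2_frame_velocity z v (omega : R) : continuous z -> is_H1_derivative z v ->
  forall j, L2_loc (fun t => (v t + omega *: J (z t)) 0 j).
Proof.
move=> cz zv j.
have lv := (zv j).1.
have lz i : L2_loc (fun t => z t 0 i).
  by apply: L2_continuous; exact: continuous_coord.
have lJ : L2_loc (fun t => J (z t) 0 j).
  case: (unliftP ord0 j) => [j' ->|->].
    case: (unliftP ord0 j') => [j'' ->|->].
      by under eq_fun do rewrite J_coord2; exact: L2_cst.
    by under eq_fun do rewrite J_coord1; exact: lz.
  under eq_fun do rewrite J_coord0.
  by apply: L2_continuous => t; apply: cvgN; exact: continuous_coord.
rewrite (_ : (fun t => _) = fun t => v t 0 j + omega * J (z t) 0 j).
  by apply: L2D => //; exact: L2Z.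
by apply/funext => t; rewrite !mxE.
Qed.

End EuclideanCoordinates.

(** * The kinetic term and the tangent lines of the potential *)

Section LowerBound.
Context {R : realType}.
Notation T := (2 * pi : R).

Lemma weak_derivativeP d (z : R -> 'rV[R]_d) : H1_loc z ->
  is_H1_derivative z (weak_derivative z).
Proof. by move=> [_ [v zv]]; exact: (xgetPex _ (ex_intro _ v zv)). Qed.

Section Kinetic.
Variables (d n k : nat) (omega : R) (kap : nat -> R).
Hypotheses (n0 : (0 < n)%N) (kap0 : forall h, 0 <= kap h).
Hypothesis norm1 : \sum_(1 <= h < n) kap h *
  ((1 - cos (k%:R * (h%:R * tau R n))) ^+ 2 +
   sin (k%:R * (h%:R * tau R n)) ^+ 2) = 1.
Hypothesis small :
  (omega - k%:R) ^+ 2 * (1 + 4 * \sum_(1 <= h < n) kap h) * T ^+ 2 <= 2^-1.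
Variables (z v : R -> 'rV[R]_d.+2).
Hypotheses (cz : continuous z) (pz : periodic z T) (zv : is_H1_derivative z v).

Let diff (h : nat) (t : R) := z t - z (t + h%:R * tau R n).
Let vel (t : R) := v t + omega *: J (z t).

(** The planar inequality and one scalar inequality for each coordinate
    orthogonal to the rotating plane, added up. *)
Lemma kinetic_ge_differences :
  (omega - k%:R) ^+ 2 * (\sum_(1 <= h < n)
     kap h * Int 0 T (fun t => edot (diff h t) (diff h t))) <=
  Int 0 T (fun t => edot (vel t) (vel t)).
Proof.
have cj j : continuous (fun t => z t 0 j) by exact: continuous_coord.
have pj j : periodic (fun t => z t 0 j) T by move=> t; rewrite pz.
have lv j := (zv j).1; have wj j := (zv j).2.
have lz j := L2_continuous (cj j).
set s := fun h => h%:R * tau R n.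
have lzs j h : L2_loc (fun t => z (t + s h) 0 j).
  exact: L2_continuous (continuous_shift (s := s h) (cj j)).
have ld j h : L2_loc (fun t => z t 0 j - z (t + s h) 0 j) by exact: L2B.
have l0 : L2_loc (fun t => v t 0 (i0 d) - omega * z t 0 (i1 d)).
  by apply: L2B => //; exact: L2Z.
have l1 : L2_loc (fun t => v t 0 (i1 d) + omega * z t 0 (i0 d)).
  by apply: L2D => //; exact: L2Z.
have velE t j : vel t 0 j = v t 0 j + omega * J (z t) 0 j.
  by rewrite /vel mxE [X in _ + X]mxE.
have Evel : Int 0 T (fun t => edot (vel t) (vel t)) =
    Int 0 T (fun t => (v t 0 (i0 d) - omega * z t 0 (i1 d)) ^+ 2 +
                      (v t 0 (i1 d) + omega * z t 0 (i0 d)) ^+ 2) +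
    \sum_(j < d) Int 0 T (fun t => v t 0 (i2 j) ^+ 2).
  have [lS ES] := @Int_sum R _ (index_enum 'I_d)
    (fun (j : 'I_d) t => v t 0 (i2 j) ^+ 2) 0 T (fun j => L2_sqr (lv _)).
  rewrite -ES -IntD//; last by apply: locintD; exact: L2_sqr.
  apply: eq_Int => t; rewrite edot_split; congr (_ + _).
    by rewrite !velE J_coord0 J_coord1 mulrN.
  by apply: eq_bigr => j _; rewrite velE J_coord2 mulr0 addr0.
have Ediff h : Int 0 T (fun t => edot (diff h t) (diff h t)) =
    Int 0 T (fun t => (z t 0 (i0 d) - z (t + s h) 0 (i0 d)) ^+ 2 +
                      (z t 0 (i1 d) - z (t + s h) 0 (i1 d)) ^+ 2) +
    \sum_(j < d) Int 0 T (fun t => (z t 0 (i2 j) - z (t + s h) 0 (i2 j)) ^+ 2).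
  have [lS ES] := @Int_sum R _ (index_enum 'I_d)
    (fun (j : 'I_d) t => (z t 0 (i2 j) - z (t + s h) 0 (i2 j)) ^+ 2) 0 T
    (fun j => L2_sqr (ld _ _)).
  rewrite -ES -IntD//; last by apply: locintD; exact: L2_sqr.
  apply: eq_Int => t; rewrite edot_split; congr (_ + _).
    by rewrite /diff !mxE.
  by apply: eq_bigr => j _; rewrite /diff !mxE.
rewrite Evel; under eq_bigr do rewrite Ediff mulrDr.
rewrite big_split/= mulrDr; apply: lerD.
  by apply: planar_kinetic_ge.
under eq_bigr do rewrite mulr_sumr.
rewrite exchange_big/= mulr_sumr; apply: ler_sum => j _.
apply: (scalar_difference_le two_pi_gt0 s (cj _) (pj _) (wj _) (lv _) kap0).
have K0 : 0 <= \sum_(1 <= h < n) kap h by apply: sumr_ge0.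
have := sqr_ge0 (omega - k%:R); have := sqr_ge0 T.
move: small; move: ((omega - k%:R) ^+ 2) (T ^+ 2) (\sum_(1 <= h < n) kap h) K0.
move=> D U K K0 H U0 D0.
have : 0 <= D * U by exact: mulr_ge0.
have : 0 <= D * U * K by rewrite !mulr_ge0.
nra.
Qed.

End Kinetic.

(** The function s |-> s^(-alpha/2) is convex; this is its tangent line at
    rho^2, read at s = x^2. *)
Lemma powR_inv_tangent (alpha rho x : R) : 0 < alpha -> 0 < rho -> 0 < x ->
  (rho `^ alpha)^-1 * (1 + alpha / 2 - alpha / 2 * (x ^+ 2 / rho ^+ 2)) <=
  (x `^ alpha)^-1.
Proof.
move=> a0 r0 x0; have y0 : 0 < x / rho by rewrite divr_gt0.
have -> : x = rho * (x / rho) by rewrite mulrC divfK ?gt_eqF.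
move: (x / rho) y0 => y y0; rewrite powRM ?(ltW r0) ?(ltW y0)//.
rewrite [leRHS]invfM ler_pM2l ?invr_gt0 ?powR_gt0//.
have -> : (rho * y) ^+ 2 / rho ^+ 2 = y ^+ 2.
  by rewrite exprMn mulrAC divff ?mul1r// expf_neq0// gt_eqF.
rewrite -powRN /powR gt_eqF//.
(* With y = x / rho: y^(-alpha) >= 1 - alpha ln y and 2 ln y <= y^2 - 1. *)
apply: le_trans (expR_ge1Dx _).
have := expR_ge1Dx (ln (y ^+ 2)).
rewrite lnK ?posrE ?exprn_gt0// lnXn// mulr2n => ly.
have := ler_wpM2l (ltW a0) ly; lra.
Qed.

End LowerBound.

(** * The lower bound for the action *)

Section Weights.
Context {R : realType}.

Lemma cos_lt1 (x : R) : 0 < x < 2 * pi -> cos x < 1.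
Proof.
move=> /andP[x0 x2]; have -> : x = (x / 2) *+ 2 by rewrite -mulr_natr divfK.
rewrite cos_mulr2n cos2sin2.
have : 0 < sin (x / 2) by apply: sin_gt0_pi; apply/andP; split; lra.
nra.
Qed.

(** Length of the h-th diagonal of the configuration traced on the unit circle
    by the k-fold rotation. *)
Definition chord (n k h : nat) : R :=
  Num.sqrt ((1 - cos (k%:R * (h%:R * tau R n))) ^+ 2 +
            sin (k%:R * (h%:R * tau R n)) ^+ 2).

Definition chord_potential (alpha : R) (n k : nat) : R :=
  \sum_(1 <= h < n) (chord n k h `^ alpha)^-1.

(** The slopes of the potential at the circle, normalized so that the weighted
    squares of the chords add up to one. *)
Definition weight (alpha : R) (n k h : nat) : R :=
  (chord n k h `^ alpha)^-1 / chord n k h ^+ 2 / chord_potential alpha n k.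

Lemma chord_sqr n k h : chord n k h ^+ 2 =
  (1 - cos (k%:R * (h%:R * tau R n))) ^+ 2 + sin (k%:R * (h%:R * tau R n)) ^+ 2.
Proof. by rewrite sqr_sqrtr// addr_ge0// sqr_ge0. Qed.

(** As k is prime to n, the angle 2 pi k h / n is not a multiple of 2 pi. *)
Lemma chord_gt0 n k h : coprime n k -> (1 <= h < n)%N -> 0 < chord n k h.
Proof.
move=> nk /andP[h0 hn].
have n0 : (0 < n)%N by exact: leq_trans hn.
have n0' : 0 < n%:R :> R by rewrite ltr0n.
rewrite sqrtr_gt0 ltr_pwDl ?sqr_ge0// exprn_even_gt0//= subr_eq0 eq_sym lt_eqF//.
set m := ((k * h) %% n)%N.
have m0 : (0 < m)%N.
  rewrite lt0n; apply/eqP => /eqP; rewrite -/(dvdn n (k * h)) Gauss_dvdr//.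
  by move=> /(dvdn_leq h0); rewrite leqNgt hn.
have mn : (m < n)%N by rewrite ltn_mod.
have -> : k%:R * (h%:R * tau R n) = m%:R * tau R n + (pi *+ 2) *+ ((k * h) %/ n).
  rewrite mulrA -natrM [in LHS](divn_eq (k * h) n) natrD natrM mulrDl addrC.
  congr (_ + _); rewrite -[RHS]mulr_natl -[pi *+ 2]mulr_natl -mulrA; congr (_ * _).
  by rewrite /tau mulrC divfK ?gt_eqF.
rewrite (periodicn (@cosD2pi R)); apply: cos_lt1.
rewrite /tau mulr_gt0 ?ltr0n ?divr_gt0 ?two_pi_gt0//=.
by rewrite mulrCA gtr_pMr ?two_pi_gt0// ltr_pdivrMr// mul1r ltr_nat.
Qed.

Variables (alpha : R) (n k : nat).
Hypotheses (n2 : (2 <= n)%N) (nk : coprime n k).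

Lemma chord_potential_gt0 : 0 < chord_potential alpha n k.
Proof.
rewrite /chord_potential big_ltn// ltr_pwDl//.
  by rewrite invr_gt0 powR_gt0// chord_gt0.
by apply: sumr_ge0 => h _; rewrite invr_ge0 powR_ge0.
Qed.

Lemma weight_ge0 h : 0 <= weight alpha n k h.
Proof.
by rewrite /weight !divr_ge0 ?invr_ge0 ?powR_ge0 ?sqr_ge0// ltW// chord_potential_gt0.
Qed.

Lemma weight_chord_sum1 : \sum_(1 <= h < n) weight alpha n k h *
  ((1 - cos (k%:R * (h%:R * tau R n))) ^+ 2 +
   sin (k%:R * (h%:R * tau R n)) ^+ 2) = 1.
Proof.
rewrite (eq_big_nat _ _ (F2 := fun h => (chord n k h `^ alpha)^-1 / chord_potential alpha n k)).
  by rewrite -mulr_suml divff// gt_eqF// chord_potential_gt0.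
move=> h hn; rewrite -chord_sqr /weight mulrAC divfK//.
by rewrite expf_neq0// gt_eqF// chord_gt0.
Qed.

End Weights.

Section Action.
Context {R : realType}.
Notation T := (2 * pi : R).

Lemma continuous_enorm_powRV d (alpha : R) (f : R -> 'rV[R]_d) : continuous f ->
  (forall t, f t != 0) -> continuous (fun t => (enorm (f t) `^ alpha)^-1).
Proof.
move=> cf f0 t.
have -> : (fun t => (enorm (f t) `^ alpha)^-1) =
    fun t => expR (- alpha * ln (enorm (f t))).
  by apply/funext => s; rewrite -powRN /powR gt_eqF// enorm_gt0.
have ce : continuous (fun t => enorm (f t)).
  have cd : continuous (fun t => edot (f t) (f t)).
    apply: continuous_big; first exact: add_continuous.
    move=> j _ s.
    have cfj : continuous (fun t => f t 0 j).
      move=> u; apply: (@continuous_comp _ _ _ f (fun u : 'rV[R]_d => u 0 j)).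
        exact: cf.
      exact: coord_continuous.
    by apply: cvgM; exact: cfj.
  move=> s; apply: (@continuous_comp _ _ _ (fun t => edot (f t) (f t)) Num.sqrt).
    exact: cd.
  exact: sqrt_continuous.
apply: (@continuous_comp _ _ _ (fun t => - alpha * ln (enorm (f t))) expR);
  last exact: continuous_expR.
apply: cvgM; first exact: cvg_cst.
apply: continuous_cvg; last exact: ce.
by apply: continuous_ln; rewrite enorm_gt0.
Qed.

Variables (d n k : nat) (alpha omega : R).
Hypothesis alpha0 : 0 < alpha.
Implicit Types (z v : R -> 'rV[R]_d.+2).

Let diff z (h : nat) (t : R) := z t - z (t + h%:R * tau R n).
Let vel z v (t : R) := v t + omega *: J (z t).

Lemma Lambda_diff z h t : Lambda n z -> (1 <= h < n)%N -> diff z h t != 0.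
Proof. by move=> [_ H] hn; rewrite subr_eq0; apply/eqP; exact: H. Qed.

Lemma continuous_diff z h : continuous z -> continuous (diff z h).
Proof.
move=> cz t; apply: cvgB; first exact: cz.
apply: (@continuous_comp _ _ _ (fun t => t + h%:R * tau R n) z); last exact: cz.
by apply: cvgD; [exact: cvg_id|exact: cvg_cst].
Qed.

(** Without collisions the potential is continuous, so the action is finite
    and can be handled with real integrals. *)
Lemma lagrangian_actionE z : Lambda n z -> lagrangian_action n alpha omega z =
  (2^-1 * Int 0 T (fun t => edot (vel z (weak_derivative z) t)
                                 (vel z (weak_derivative z) t)) +
   2^-1 * \sum_(1 <= h < n) Int 0 T (fun t => (enorm (diff z h t) `^ alpha)^-1))%:E.
Proof.
move=> Lz; have [[cz _ /weak_derivativeP zv] _] := Lz.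
rewrite /lagrangian_action EFinD !EFinM; congr (_ + _)%E; congr (_ * _)%E.
  rewrite -integral_Int.
    by apply: eq_integral => t _; rewrite enorm_sqr.
  by apply: locint_edot; exact: L2_frame_velocity.
rewrite -sumEFin; apply: eq_big_nat => h hn; rewrite integral_Int//.
apply: locint_continuous; apply: continuous_enorm_powRV.
  exact: continuous_diff.
by move=> t; exact: Lambda_diff.
Qed.

Hypotheses (n2 : (2 <= n)%N) (nk : coprime n k).
Variable r : R.
Hypotheses (r0 : 0 < r).
Local Notation S := (chord_potential alpha n k).
Local Notation kap := (weight alpha n k).
Hypothesis balance : r `^ alpha * r ^+ 2 * (2 * (omega - k%:R) ^+ 2) = alpha * S.
Hypothesis small :
  (omega - k%:R) ^+ 2 * (1 + 4 * \sum_(1 <= h < n) kap h) * T ^+ 2 <= 2^-1.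

(** The tangent lines taken at the chords of the circle of radius r have slopes
    that the balance equation turns into delta^2 times the weights, so that the
    quadratic parts cancel against the kinetic term. *)
Lemma action_ge z : Lambda n z ->
  ((2^-1 * ((1 + alpha / 2) * T * ((r `^ alpha)^-1 * S)))%:E <=
   lagrangian_action n alpha omega z)%E.
Proof.
move=> Lz; have [[cz pz /weak_derivativeP zv] _] := Lz.
rewrite lagrangian_actionE// lee_fin -mulrDr ler_pM2l ?invr_gt0//.
set I := (X in _ <= X + _).
have n0 : (0 < n)%N by exact: leq_trans n2.
have kin := kinetic_ge_differences n0 (weight_ge0 alpha n2 nk)
  (weight_chord_sum1 alpha n2 nk) small cz pz zv.
have D2 : (omega - k%:R) ^+ 2 = alpha / 2 * S / (r `^ alpha * r ^+ 2).
  have -> : alpha / 2 * S = alpha * S / 2 by ring.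
  by rewrite -balance; field; rewrite !gt_eqF ?powR_gt0.
have S0 := chord_potential_gt0 alpha n2 nk.
have step h : (1 <= h < n)%N ->
  (1 + alpha / 2) * T * ((r `^ alpha)^-1 * (chord n k h `^ alpha)^-1) -
    (omega - k%:R) ^+ 2 * (kap h * Int 0 T (fun t => edot (diff z h t) (diff z h t))) <=
  Int 0 T (fun t => (enorm (diff z h t) `^ alpha)^-1).
  move=> hn; have c0 := @chord_gt0 R _ _ _ nk hn.
  set A := (r `^ alpha)^-1 * _.
  have ld : locint (fun t => edot (diff z h t) (diff z h t)).
    apply: locint_edot => j; apply: L2_continuous; apply: continuous_coord.
    exact: continuous_diff.
  have -> : (1 + alpha / 2) * T * A = ((1 + alpha / 2) * A) * (T - 0) by ring.
  rewrite -Int_cst; last exact: ltW two_pi_gt0.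
  rewrite mulrA -IntZ// -IntB; [|exact: locint_cst|exact: locintZ].
  apply: le_Int; first by apply: locintB; [exact: locint_cst|exact: locintZ].
    apply: locint_continuous; apply: continuous_enorm_powRV.
      exact: continuous_diff.
    by move=> t; exact: Lambda_diff.
  move=> t _; have e0 : 0 < enorm (diff z h t) by rewrite enorm_gt0// Lambda_diff.
  have := powR_inv_tangent alpha0 (mulr_gt0 r0 c0) e0.
  rewrite enorm_sqr powRM ?(ltW r0) ?(ltW c0)//; apply: le_trans.
  rewrite le_eqVlt; apply/orP; left; apply/eqP.
  rewrite D2 /weight /A; field.
  by rewrite !gt_eqF ?powR_gt0.
have := @ler_sum_nat R 1 n _ _ (fun h hn => step h hn).
rewrite sumrB -!mulr_sumr -/S; move: kin; rewrite -/I; lra.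
Qed.

End Action.

(** * The circle *)

Section Circle.
Context {R : realType}.
Notation T := (2 * pi : R).

Lemma is_weak_derivative_is_derive (F G : R -> R) :
  (forall t : R, is_derive t 1 F (G t)) -> continuous G -> is_weak_derivative F G.
Proof.
move=> FG cG; have E : derive1 F = G.
  by apply/funext => t; rewrite derive1E; exact: (@derive_val _ _ _ _ _ _ _ (FG t)).
rewrite -E; apply: is_weak_derivative_derive1; last by rewrite E.
by move=> t; have [] := FG t.
Qed.

Variables (d n k : nat) (r : R).
Implicit Types t : R.

(** Clockwise, against the rotation of the frame; the summand 0 is the centre. *)
Definition circle t : 'rV[R]_d.+2 :=
  0 + r *: (cos (k%:R * t) *: delta_mx 0 (i0 d) +
            sin (k%:R * t) *: - delta_mx 0 (i1 d)).

Definition circle_velocity t : 'rV[R]_d.+2 :=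
  r *: (- (k%:R * sin (k%:R * t)) *: delta_mx 0 (i0 d) +
        (k%:R * cos (k%:R * t)) *: - delta_mx 0 (i1 d)).

Lemma circle_coord0 t : circle t 0 (i0 d) = r * cos (k%:R * t).
Proof. by rewrite !mxE/= mulr1n mulr0n oppr0 mulr0 addr0 add0r mulr1. Qed.

Lemma circle_coord1 t : circle t 0 (i1 d) = - (r * sin (k%:R * t)).
Proof. by rewrite !mxE/= mulr1n mulr0n mulr0 !add0r mulrN1 mulrN. Qed.

Lemma circle_coord2 t j : circle t 0 (i2 j) = 0.
Proof. by rewrite !mxE/= !(oppr0, mulr0, addr0). Qed.

Lemma circle_velocity_coord0 t :
  circle_velocity t 0 (i0 d) = - (r * (k%:R * sin (k%:R * t))).
Proof. by rewrite !mxE/= mulr1n mulr0n oppr0 mulr0 addr0 mulr1 mulrN. Qed.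

Lemma circle_velocity_coord1 t :
  circle_velocity t 0 (i1 d) = - (r * (k%:R * cos (k%:R * t))).
Proof. by rewrite !mxE/= mulr1n mulr0n mulr0 add0r mulrN1 mulrN. Qed.

Lemma circle_velocity_coord2 t j : circle_velocity t 0 (i2 j) = 0.
Proof. by rewrite !mxE/= !(oppr0, mulr0, addr0). Qed.

Lemma circle_continuous : continuous circle.
Proof.
move=> t; apply: cvgD; first exact: cvg_cst.
apply: cvgZ; first exact: cvg_cst.
apply: cvgD; apply: cvgZ; try exact: cvg_cst.
  exact: continuous_cosZ.
exact: continuous_sinZ.
Qed.

Lemma circle_H1_derivative : is_H1_derivative circle circle_velocity.
Proof.
have cs0 : continuous (fun t => - (r * (k%:R * sin (k%:R * t)))).
  move=> t; apply: cvgN; apply: cvgM; first exact: cvg_cst.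
  by apply: cvgM; [exact: cvg_cst|exact: continuous_sinZ].
have cc0 : continuous (fun t => - (r * (k%:R * cos (k%:R * t)))).
  move=> t; apply: cvgN; apply: cvgM; first exact: cvg_cst.
  by apply: cvgM; [exact: cvg_cst|exact: continuous_cosZ].
move=> j; case: (unliftP ord0 j) => [j' ->|->].
  case: (unliftP ord0 j') => [j'' ->|->].
    rewrite (funext (fun t => circle_velocity_coord2 t j'')).
    rewrite (funext (fun t => circle_coord2 t j'')).
    split; first exact: L2_cst.
    apply: is_weak_derivative_is_derive => t; last exact: cvg_cst.
  rewrite (funext circle_velocity_coord1) (funext circle_coord1).
  split; first exact: L2_continuous.
  apply: is_weak_derivative_is_derive => // t.
  have D := @is_derive_sinZ R k%:R t.
  by apply: is_derive_eq; rewrite /GRing.scale/=; ring.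
rewrite (funext circle_velocity_coord0) (funext circle_coord0).
split; first exact: L2_continuous.
apply: is_weak_derivative_is_derive => // t.
have D := @is_derive_cosZ R k%:R t.
by apply: is_derive_eq; rewrite /GRing.scale/=; ring.
Qed.

Lemma circle_periodic : periodic circle T.
Proof. by move=> t; rewrite /circle cos_nat_periodic sin_nat_periodic. Qed.

Lemma circle_H1_2pi : H1_2pi circle.
Proof.
split; [exact: circle_continuous|exact: circle_periodic|split].
  move=> j; apply: L2_continuous; apply: continuous_coord.
  exact: circle_continuous.
by exists circle_velocity; exact: circle_H1_derivative.
Qed.

Lemma row_subE m (a b : 'rV[R]_m) j : (a - b) 0 j = a 0 j - b 0 j.
Proof. by rewrite !mxE. Qed.

Lemma circle_diff_edot h t :
  edot (circle t - circle (t + h%:R * tau R n))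
       (circle t - circle (t + h%:R * tau R n)) = (r * chord n k h) ^+ 2.
Proof.
rewrite edot_split exprMn chord_sqr big1 => [|j _]; last first.
  by rewrite row_subE !circle_coord2 subrr expr0n.
rewrite !row_subE !circle_coord0 !circle_coord1 mulrDr cosD sinD addr0.
have CS := cos2Dsin2 (k%:R * t).
move: (cos (k%:R * t)) (sin (k%:R * t)) CS => x y CS.
move: (cos _) (sin _) => c s.
rewrite -[RHS]mul1r -[X in _ = X * _]CS; ring.
Qed.

Lemma circle_velocity_edot (omega : R) t :
  edot (circle_velocity t + omega *: J (circle t))
       (circle_velocity t + omega *: J (circle t)) = (omega - k%:R) ^+ 2 * r ^+ 2.
Proof.
have E j : (circle_velocity t + omega *: J (circle t)) 0 j =
    circle_velocity t 0 j + omega * J (circle t) 0 j.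
  by rewrite mxE [X in _ + X]mxE.
rewrite edot_split big1 => [|j _]; last first.
  by rewrite E circle_velocity_coord2 J_coord2 mulr0 addr0 expr0n.
rewrite !E J_coord0 J_coord1 circle_coord0 circle_coord1 circle_velocity_coord0.
rewrite circle_velocity_coord1 addr0.
have CS := cos2Dsin2 (k%:R * t).
move: (cos (k%:R * t)) (sin (k%:R * t)) CS => x y CS.
rewrite -[RHS]mul1r -[X in _ = X * _]CS; ring.
Qed.

Hypotheses (n2 : (2 <= n)%N) (nk : coprime n k) (r0 : 0 < r).

Lemma circle_Lambda : Lambda n circle.
Proof.
split; first exact: circle_H1_2pi.
move=> t h hn /eqP; rewrite -subr_eq0 => /eqP E.
have := circle_diff_edot h t; rewrite E => /esym/eqP.
have -> : edot (0 : 'rV[R]_d.+2) 0 = 0.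
  by rewrite /edot big1// => j _; rewrite mxE mul0r.
by rewrite sqrf_eq0 mulf_eq0 !gt_eqF// chord_gt0.
Qed.

(** The weak derivative is only known up to a null set, which the integral does
    not see. *)
Lemma circle_kinetic (omega : R) :
  Int 0 T (fun t => edot (weak_derivative circle t + omega *: J (circle t))
                         (weak_derivative circle t + omega *: J (circle t))) =
  (omega - k%:R) ^+ 2 * r ^+ 2 * T.
Proof.
have wd : is_H1_derivative circle (weak_derivative circle).
  by apply: weak_derivativeP; have [] := circle_H1_2pi.
have cd := circle_H1_derivative; have cc := circle_continuous.
transitivity (Int 0 T (fun t => edot (circle_velocity t + omega *: J (circle t))
                         (circle_velocity t + omega *: J (circle t)))); last first.
  rewrite (eq_Int _ _ (fun t => circle_velocity_edot omega t)) Int_cst ?subr0//.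
  exact: ltW two_pi_gt0.
have l1 := locint_edot (L2_frame_velocity omega cc wd).
have l2 := locint_edot (L2_frame_velocity omega cc cd).
rewrite /Rintegral; congr fine; apply: ae_eq_integral => //.
- by have [m _ _] := l1; exact/measurable_EFinP/measurable_funTS.
- by have [m _ _] := l2; exact/measurable_EFinP/measurable_funTS.
have H j := weak_derivative_ae_unique 0 T (continuous_coord (j := j) cc) (wd j).2 (cd j).2.
have FF := ae_filter_ringOfSetsType (@lebesgue_measure R).
have := filter_forall FF H; apply: filterS => t Ht It; congr EFin.
suff -> : weak_derivative circle t = circle_velocity t by [].
by apply/rowP => j; exact: Ht.
Qed.

Lemma circle_action (alpha omega : R) :
  r `^ alpha * r ^+ 2 * (2 * (omega - k%:R) ^+ 2) = alpha * chord_potential alpha n k ->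
  lagrangian_action n alpha omega circle =
  (2^-1 * ((1 + alpha / 2) * T * ((r `^ alpha)^-1 * chord_potential alpha n k)))%:E.
Proof.
move=> balance; rewrite lagrangian_actionE; last exact: circle_Lambda.
rewrite circle_kinetic -mulrDr; congr (_ * _)%:E.
rewrite (eq_big_nat _ _ (F2 := fun h => (r `^ alpha)^-1 * T * (chord n k h `^ alpha)^-1)).
  rewrite -mulr_sumr -/(chord_potential _ _ _).
  have -> : (omega - k%:R) ^+ 2 * r ^+ 2 * T =
      (r `^ alpha)^-1 * (r `^ alpha * r ^+ 2 * (2 * (omega - k%:R) ^+ 2)) * (T / 2).
    by field; rewrite gt_eqF// powR_gt0.
  by rewrite balance; field; rewrite gt_eqF// powR_gt0.
move=> h hn.
have c0 := @chord_gt0 R _ _ _ nk hn.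
rewrite (@eq_Int _ _ _ _ (fun=> (r `^ alpha)^-1 * (chord n k h `^ alpha)^-1)).
  by rewrite Int_cst ?(ltW two_pi_gt0)// subr0; ring.
move=> t; rewrite /enorm circle_diff_edot sqrtr_sqr ger0_norm.
  by rewrite powRM ?(ltW r0) ?(ltW c0)// invfM.
by rewrite mulr_ge0 ?(ltW r0) ?(ltW c0).
Qed.

Lemma circle_is_circle : (0 < k)%N -> is_circle circle r.
Proof.
move=> k0; split => //.
have e1 (j : 'I_d.+2) : enorm (delta_mx 0 j : 'rV[R]_d.+2) = 1.
  rewrite /enorm /edot (bigD1 j)//= !mxE !eqxx mulr1 big1 ?addr0 ?sqrtr1// => i ij.
  by rewrite !mxE (negbTE ij) andbF mul0r.
exists 0, (delta_mx 0 (i0 d)), (- delta_mx 0 (i1 d)), k%:R; split => //.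
- rewrite /enorm -(e1 (i1 d)) /enorm; congr Num.sqrt.
  by apply: eq_bigr => j _; rewrite !mxE mulrNN.
- rewrite /edot big1// => j _; rewrite !mxE/=.
  case: (unliftP ord0 j) => [j' ->|->]; first by rewrite mul0r.
  by rewrite oppr0 mulr0.
- by rewrite ltr0n.
Qed.

(** Returning to the starting point after time s forces cos (k s) = 1, hence
    2 pi <= k s. *)
Lemma circle_minimal_period : (0 < k)%N -> is_minimal_period circle (T / k%:R).
Proof.
move=> k0; have k0' : 0 < k%:R :> R by rewrite ltr0n.
split; first by rewrite divr_gt0// two_pi_gt0.
- move=> t; rewrite /circle mulrDr (mulrC _ (T / _)) divfK ?gt_eqF//.
  have T2 : T = pi *+ 2 by rewrite -[RHS]mulr_natl.
  have cT x : cos (x + T) = cos x :> R by rewrite T2 cosD2pi.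
  have sT x : sin (x + T) = sin x :> R by rewrite T2 sinD2pi.
  by rewrite cT sT.
- move=> s s0 ps; rewrite ler_pdivrMr// leNgt; apply/negP => sk.
  have := congr1 (fun u : 'rV[R]_d.+2 => u 0 (i0 d)) (ps 0).
  rewrite /= !circle_coord0 add0r mulr0 cos0 => /(mulfI (lt0r_neq0 r0)) E.
  have : cos (k%:R * s) < 1 by apply: cos_lt1; rewrite mulr_gt0//= mulrC.
  by rewrite E ltxx.
Qed.

Lemma circle_in_rotating_plane : in_rotating_plane circle.
Proof.
move=> t j; case: (unliftP ord0 j) => [j' ->|-> //].
by case: (unliftP ord0 j') => [j'' -> _|-> //]; exact: circle_coord2.
Qed.

End Circle.

(** * The window around k and the radius *)

Section Window.
Context {R : realType}.

(** With K the sum of the weights and T = 2 pi this is 1 / (2 T (1 + 4 K)): a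
    smaller delta makes delta^2 (1 + 4 K) T^2 at most 1/2, as the quadratic
    inequality requires, and keeps omega within 1/2 of k. *)
Definition window (alpha : R) (n k : nat) : R :=
  (2 * (2 * pi) * (1 + 4 * \sum_(1 <= h < n) weight alpha n k h))^-1.

(** The integer nearest to omega recovers the winding number k. *)
Definition circle_radius (n : nat) (alpha omega : R) : R :=
  let k := Num.truncn (omega + 2^-1) in
  (alpha * chord_potential alpha n k / (2 * (omega - k%:R) ^+ 2))
    `^ (alpha + 2)^-1.

Variables (alpha omega : R) (n k : nat).
Hypotheses (n2 : (2 <= n)%N) (nk : coprime n k) (alpha0 : 0 < alpha).

Let K := \sum_(1 <= h < n) weight alpha n k h.

Let K0 : 0 <= K.
Proof. by apply: sumr_ge0 => h _; exact: weight_ge0. Qed.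

Let two_pi_ge4 : 4 <= 2 * pi :> R.
Proof. by have := @pi_ge2 R; lra. Qed.

Lemma window_gt0 : 0 < window alpha n k.
Proof.
rewrite invr_gt0 !mulr_gt0 ?pi_gt0// -/K.
by have := K0; lra.
Qed.

Lemma window_le : window alpha n k <= 2^-1.
Proof.
rewrite /window -/K; have W0 := K0; have T4 := two_pi_ge4.
rewrite lef_pV2 ?posrE// -mulrA ?ler_peMr//; last first.
  by rewrite !mulr_gt0 ?pi_gt0//; lra.
nra.
Qed.

Hypothesis omega_window :
  k%:R - window alpha n k < omega < k%:R + window alpha n k.

Lemma window_small :
  (omega - k%:R) ^+ 2 * (1 + 4 * K) * (2 * pi) ^+ 2 <= 2^-1.
Proof.
have W0 := K0; have T4 := two_pi_ge4.
have k1 : 1 <= 1 + 4 * K by lra.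
have E : window alpha n k * (2 * (2 * pi) * (1 + 4 * K)) = 1.
  by rewrite /window -/K mulVf// gt_eqF// !mulr_gt0 ?pi_gt0//; lra.
have w0 := window_gt0.
have /andP[w1 w2] := omega_window.
have D : (omega - k%:R) ^+ 2 <= window alpha n k ^+ 2.
  rewrite -(real_normK (num_real (omega - _))) ler_sqr ?nnegrE ?(ltW w0)//.
  by rewrite ler_norml; apply/andP; split; lra.
move: E w0 D; move: (window _ _ _) ((omega - _) ^+ 2) (1 + 4 * K) k1 => w D c c1 E w0 Dw.
have c0 : 0 <= c * (2 * pi) ^+ 2 by rewrite mulr_ge0 ?sqr_ge0//; lra.
rewrite -mulrA; apply: (le_trans (ler_wpM2r c0 Dw)).
have -> : w ^+ 2 * (c * (2 * pi) ^+ 2) = (w * (2 * (2 * pi) * c)) * (w * (2 * pi)) / 2.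
  by field.
rewrite E mul1r ler_pdivrMr// mulVf//.
rewrite -[leRHS]E; have -> : w * (2 * (2 * pi) * c) = w * (2 * pi) * (2 * c) by ring.
rewrite ler_peMr//; last by lra.
by rewrite mulr_ge0 ?(ltW w0)//; lra.
Qed.

Lemma truncn_window : Num.truncn (omega + 2^-1) = k.
Proof.
have w0 := window_le; have /andP[w1 w2] := omega_window.
by apply: truncn_def; rewrite -(natr1 k); apply/andP; split; lra.
Qed.

Hypothesis omega_k : omega != k%:R.

Lemma circle_radius_gt0 : 0 < circle_radius n alpha omega.
Proof.
rewrite /circle_radius truncn_window powR_gt0// divr_gt0//.
  by rewrite mulr_gt0// chord_potential_gt0.
by rewrite mulr_gt0// exprn_even_gt0//= subr_eq0.
Qed.

Lemma circle_radius_balance :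
  circle_radius n alpha omega `^ alpha * circle_radius n alpha omega ^+ 2 *
    (2 * (omega - k%:R) ^+ 2) = alpha * chord_potential alpha n k.
Proof.
have r0 := circle_radius_gt0.
have D0 : 2 * (omega - k%:R) ^+ 2 != 0.
  by rewrite mulf_neq0// expf_neq0// subr_eq0.
rewrite -(@powR_mulrn _ _ 2) ?(ltW r0)// -powRD; last first.
  by rewrite (gt_eqF r0) implybT.
rewrite /circle_radius truncn_window -powRrM mulVf; last by rewrite gt_eqF// addr_gt0.
rewrite powRr1 ?divfK//.
have S0 := chord_potential_gt0 alpha n2 nk.
apply: divr_ge0; apply: mulr_ge0 => //; [exact: ltW|exact: ltW|exact: sqr_ge0].
Qed.

End Window.

Theorem theorem3 (R : realType) :
  exists (eps : R -> nat -> nat -> R) (rho : nat -> R -> R -> R),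
  forall (n d k : nat) (alpha : R),
    (2 <= n)%N -> (2 <= d)%N -> 0 < alpha -> (0 < k)%N -> coprime n k ->
    0 < eps alpha n k /\
    forall omega : R, 0 < omega ->
      k%:R - eps alpha n k < omega < k%:R + eps alpha n k ->
      omega \isn't a Num.nat ->
      exists y : R -> 'rV[R]_d,
        [/\ Lambda n y,
            forall z : R -> 'rV[R]_d, Lambda n z ->
              (lagrangian_action n alpha omega y <= lagrangian_action n alpha omega z)%E,
            is_circle y (rho n alpha omega),
            is_minimal_period y (2 * pi / k%:R) &
            in_rotating_plane y].
Proof.
exists window, circle_radius => n [|[|d]]// k alpha n2 _ alpha0 k0 nk.
split=> [|omega _ omegaW omegaN]; first exact: window_gt0.
have omega_k : omega != k%:R by apply: contraNneq omegaN => ->; exact: natr_nat.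
have r0 := circle_radius_gt0 n2 nk alpha0 omegaW omega_k.
have balance := circle_radius_balance n2 nk alpha0 omegaW omega_k.
have small := window_small n2 nk omegaW.
exists (circle d k (circle_radius n alpha omega)); split.
- exact: circle_Lambda.
- move=> z Lz; rewrite (circle_action d nk r0 balance).
  exact: action_ge.
- exact: circle_is_circle.
- exact: circle_minimal_period.
- exact: circle_in_rotating_plane.
Qed.
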